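(* Let $p$ be an odd prime, $\Bbbk$ a field of characteristic $p$, $G=\langle\sigma\rangle$ a cyclic group of order $p$, $1\le n\le p$, $V=V_3$ and $W=V_n$. Then $\Bbbk[V,W]^G$ is a Cohen-Macaulay $\Bbbk[V]^G$-module, generated over $A=\Bbbk[a_1,a_2,a_3]$ by $$\{\Theta(M_0),\Theta(M_1),\ldots,\Theta(M_{n-1}),\ \Theta(\Delta^{p-n}(P_0)),\Theta(\Delta^{p-n}(P_1)),\ldots,\Theta(\Delta^{p-n}(P_{n-1}))\}.$$
   Context: $V_i$ denotes the indecomposable $\Bbbk G$-module of dimension $i$ ($1\le i\le p$), on which $\sigma$ acts by a single unipotent Jordan block of size $i$. $\Bbbk[V]=S(V^* )$ and $\Bbbk[V,W]=S(V^* )\otimes W$ with diagonal $G$-action; $\Bbbk[V]^G$ is the ring of invariants and $\Bbbk[V,W]^G=(S(V^* )\otimes W)^G$ is the $\Bbbk[V]^G$-module of covariants. For $V=V_3$, $\Bbbk[V]=\Bbbk[x_1,x_2,x_3]$ with $\sigma x_1=x_1+x_2$, $\sigma x_2=x_2+x_3$, $\sigma x_3=x_3$. $W=V_n$ has basis $w_1,\ldots,w_n$ with $\sigma w_i=w_i-w_{i-1}+w_{i-2}-\cdots\pm w_1$ for all $i$. Let $\Delta=\sigma-1$ acting on $\Bbbk[V]$, $K_n=\ker(\Delta^n)\subseteq\Bbbk[V]$, and $\Theta:K_n\to\Bbbk[V,W]^G$, $\Theta(f)=\sum_{i=1}^n\Delta^{i-1}(f)\,w_i$. The invariants $a_1=x_3$,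 $a_2=x_2^2-2x_1x_3-x_2x_3$, $a_3=\prod_{i=0}^{p-1}\sigma^i(x_1)$ form a homogeneous system of parameters of $\Bbbk[V]^G$. For $0\le i\le n-1$: $M_i=x_1^{i/2}$ if $i$ is even and $M_i=x_1^{(i-1)/2}x_2$ if $i$ is odd; $P_0=x_1^{p-1}x_2$, $P_i=\Delta(x_1^{p-i/2})$ if $i>0$ is even, and $P_i=x_1^{p-(i+1)/2}$ if $i$ is odd. *)

(* Defs.v *)
From HB Require Import structures.
From mathcomp Require Import all_boot all_order all_algebra.
From mathcomp Require Export mpoly.

Set Implicit Arguments.
Unset Strict Implicit.
Unset Printing Implicit Defensive.

Import GRing.Theory.
Local Open Scope ring_scope.

Section CommutativeAlgebra.

Definition spanned (R : nzRingType) (M : lmodType R) (A : R -> Prop)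
    (s : seq M) (m : M) : Prop :=
  exists c : 'I_(size s) -> R,
    (forall i, A (c i)) /\ m = \sum_(i < size s) c i *: s`_i.

Definition finitely_generated (R : nzRingType) (M : lmodType R) : Prop :=
  exists s : seq M, forall m, spanned (fun=> True) s m.

Definition is_max (P : nat -> Prop) (d : nat) : Prop :=
  P d /\ forall e, P e -> (e <= d)%N.

Variable R : comNzRingType.

(* Ideals are Prop-valued: an arbitrary ideal has no decidable membership. *)
Definition ideal (I : R -> Prop) : Prop :=
  [/\ I 0, forall x y, I x -> I y -> I (x + y) & forall a x, I x -> I (a * x)].

Definition prime_ideal (I : R -> Prop) : Prop :=
  [/\ ideal I, ~ I 1 & forall x y, I (x * y) -> I x \/ I y].

Variable M : lmodType R.

Definition annihilator (a : R) : Prop := forall m : M, a *: m = 0.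

(* P 0, ..., P d are primes of R containing Ann M and strictly increasing;
   they correspond to the chains of length d of primes of R / Ann M. *)
Definition prime_chain (d : nat) (P : nat -> R -> Prop) : Prop :=
  [/\ forall i, (i <= d)%N -> prime_ideal (P i),
      forall i, (i <= d)%N -> forall a, annihilator a -> P i a &
      forall i, (i < d)%N ->
        (forall a, P i a -> P i.+1 a) /\ (exists a, P i.+1 a /\ ~ P i a)].

Definition has_dim : nat -> Prop :=
  is_max (fun d => exists P, prime_chain d P).

(* The submodule (s_0, ..., s_(r-1)) M. *)
Definition ideal_mul (s : seq R) (m : M) : Prop :=
  exists c : 'I_(size s) -> M, m = \sum_(i < size s) s`_i *: c i.

Definition regular_sequence (s : seq R) : Prop :=
  (forall i, (i < size s)%N -> forall m : M,
     ideal_mul (take i s) (s`_i *: m) -> ideal_mul (take i s) m)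
  /\ ~ (forall m, ideal_mul s m).

Definition has_depth (I : R -> Prop) : nat -> Prop :=
  is_max (fun r => exists s : seq R,
    [/\ size s = r, forall i, (i < r)%N -> I s`_i & regular_sequence s]).

(* For R positively graded and connected, with homogeneous maximal ideal I. *)
Definition cohen_macaulay (I : R -> Prop) : Prop :=
  finitely_generated M /\ exists d, has_dim d /\ has_depth I d.

End CommutativeAlgebra.

Arguments cohen_macaulay {R} M I.

Notation kV k := {mpoly k[3]}.

(* k[V,W] is the free k[V]-module on the basis w_1, ..., w_n of W = V_n, written
   as row vectors; indices start at 0, so that column i carries w_(i+1). *)
Notation kVW k n := 'rV[{mpoly k[3]}]_n.

Section Covariants.

Variable k : fieldType.

Definition x1 : kV k := 'X_(@Ordinal 3 0 isT).
Definition x2 : kV k := 'X_(@Ordinal 3 1 isT).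
Definition x3 : kV k := 'X_(@Ordinal 3 2 isT).

Definition sigma (f : kV k) : kV k := f \mPo [tuple x1 + x2; x2 + x3; x3].

HB.instance Definition _ := GRing.RMorphism.copy sigma
  (@comp_mpoly 3 k 3 [tuple x1 + x2; x2 + x3; x3]).

Definition Delta (f : kV k) : kV k := sigma f - f.

(* Row i holds the coordinates of sigma w_i = w_i - w_(i-1) + w_(i-2) - ... *)
Definition sigma_W (n : nat) : 'M[kV k]_n :=
  \matrix_(i < n, j < n) (if (j <= i)%N then (-1) ^+ (i - j) else 0).

(* The diagonal action: sigma (f w) = sigma f * sigma w. *)
Definition sigma_VW (n : nat) (phi : kVW k n) : kVW k n :=
  map_mx sigma phi *m sigma_W n.

(* The elements of G are the powers sigma ^ i with 0 <= i < p. *)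
Definition invariants (p : nat) : {pred kV k} :=
  fun f => [forall i : 'I_p, iter i sigma f == f].

Definition covariants (p n : nat) : {pred kVW k n} :=
  fun phi => [forall i : 'I_p, iter i (@sigma_VW n) phi == phi].

Arguments invariants : clear implicits.
Arguments covariants : clear implicits.

Section Closure.

Variables p n : nat.

Lemma invariantsP f :
  reflect (forall i : 'I_p, iter i sigma f = f) (f \in invariants p).
Proof. exact: 'forall_eqP. Qed.

Lemma covariantsP (phi : kVW k n) :
  reflect (forall i : 'I_p, iter i (@sigma_VW n) phi = phi)
          (phi \in covariants p n).
Proof. exact: 'forall_eqP. Qed.

Lemma iter_sigmaB i : {morph iter i sigma : f g / f - g}.
Proof. by elim: i => // i IHi f g; rewrite !iterS IHi rmorphB. Qed.

Lemma iter_sigmaM i : {morph iter i sigma : f g / f * g}.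
Proof. by elim: i => // i IHi f g; rewrite !iterS IHi rmorphM. Qed.

Lemma iter_sigma1 i : iter i sigma 1 = 1.
Proof. by elim: i => // i IHi; rewrite !iterS IHi rmorph1. Qed.

Lemma sigma_VWB : {morph @sigma_VW n : phi psi / phi - psi}.
Proof. by move=> phi psi; rewrite /sigma_VW map_mxB mulmxBl. Qed.

Lemma sigma_VWZ f (phi : kVW k n) :
  sigma_VW (f *: phi) = sigma f *: sigma_VW phi.
Proof. by rewrite /sigma_VW map_mxZ -scalemxAl. Qed.

Lemma iter_sigma_VWB i : {morph iter i (@sigma_VW n) : phi psi / phi - psi}.
Proof. by elim: i => // i IHi phi psi; rewrite !iterS IHi sigma_VWB. Qed.

Lemma iter_sigma_VWZ i f (phi : kVW k n) :
  iter i (@sigma_VW n) (f *: phi) = iter i sigma f *: iter i (@sigma_VW n) phi.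
Proof. by elim: i => // i IHi; rewrite !iterS IHi sigma_VWZ. Qed.

Lemma invariants_subring_closed : subring_closed (invariants p).
Proof.
split=> [|f g /invariantsP fP /invariantsP gP|f g /invariantsP fP /invariantsP gP];
  apply/invariantsP => i.
- exact: iter_sigma1.
- by rewrite iter_sigmaB fP gP.
- by rewrite iter_sigmaM fP gP.
Qed.

HB.instance Definition _ :=
  GRing.isSubringClosed.Build (kV k) (invariants p) invariants_subring_closed.

Lemma covariants_zmod_closed : zmod_closed (covariants p n).
Proof.
split=> [|phi psi /covariantsP phiP /covariantsP psiP]; apply/covariantsP => i.
  by rewrite -[X in iter _ _ X](subrr 0) iter_sigma_VWB subrr.
by rewrite iter_sigma_VWB phiP psiP.
Qed.

HB.instance Definition _ :=
  GRing.isZmodClosed.Build (kVW k n) (covariants p n) covariants_zmod_closed.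

End Closure.

(* The ring k[V]^G. *)
Record kVG (p : nat) :=
  Invariant { inv_val : kV k; inv_valP : inv_val \in invariants p }.

HB.instance Definition _ p := [isSub for @inv_val p].
HB.instance Definition _ p := [Choice of kVG p by <:].
HB.instance Definition _ p := [SubChoice_isSubComNzRing of kVG p by <:].

(* The k[V]^G-module k[V,W]^G. *)
Record kVWG (p n : nat) :=
  Covariant { cov_val : kVW k n; cov_valP : cov_val \in covariants p n }.

HB.instance Definition _ p n := [isSub for @cov_val p n].
HB.instance Definition _ p n := [Choice of kVWG p n by <:].
HB.instance Definition _ p n := [SubChoice_isSubZmodule of kVWG p n by <:].

Section CovariantModule.

Variables p n : nat.
Implicit Types (f g : kVG p) (phi psi : kVWG p n).

Lemma cov_scale_subproof f phi :
  inv_val f *: cov_val phi \in covariants p n.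
Proof.
apply/covariantsP => i; rewrite iter_sigma_VWZ.
by rewrite (invariantsP _ _ (inv_valP f)) (covariantsP _ _ (cov_valP phi)).
Qed.

Definition cov_scale f phi : kVWG p n := Covariant (cov_scale_subproof f phi).

Lemma cov_scaleA f g phi :
  cov_scale f (cov_scale g phi) = cov_scale (f * g) phi.
Proof. by apply: val_inj; rewrite /= scalerA. Qed.

Lemma cov_scale1 : left_id 1 cov_scale.
Proof. by move=> phi; apply: val_inj; rewrite /= scale1r. Qed.

Lemma cov_scaleDr : right_distributive cov_scale +%R.
Proof. by move=> f phi psi; apply: val_inj; rewrite /= scalerDr. Qed.

Lemma cov_scaleDl phi : {morph cov_scale^~ phi : f g / f + g}.
Proof. by move=> f g; apply: val_inj; rewrite /= scalerDl. Qed.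

HB.instance Definition _ := GRing.Zmodule_isLmodule.Build (kVG p) (kVWG p n)
  cov_scaleA cov_scale1 cov_scaleDr cov_scaleDl.

End CovariantModule.

(* The ideal of k[V]^G spanned by the invariants of positive degree. *)
Definition kVG_plus (p : nat) (f : kVG p) : Prop := (inv_val f)@_0%MM = 0.

(* Theta f is a covariant if and only if Delta^n f = 0. *)
Definition Theta (n : nat) (f : kV k) : kVW k n := \row_(i < n) iter i Delta f.

Definition a1 : kV k := x3.
Definition a2 : kV k := x2 ^+ 2 - 2%:R * x1 * x3 - x2 * x3.
Definition a3 (p : nat) : kV k := \prod_(i < p) iter i sigma x1.

(* The subalgebra k[a1, a2, a3] of k[V]. *)
Definition algA (p : nat) (f : kV k) : Prop :=
  exists P : {mpoly k[3]}, f = P \mPo [tuple a1; a2; a3 p].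

Definition genM (i : nat) : kV k :=
  if odd i then x1 ^+ (i.-1)./2 * x2 else x1 ^+ i./2.

Definition genP (p i : nat) : kV k :=
  if i == 0%N then x1 ^+ p.-1 * x2
  else if odd i then x1 ^+ (p - (i.+1)./2) else Delta (x1 ^+ (p - i./2)).

Definition generators (p n : nat) : seq (kVW k n) :=
  [seq Theta n (genM i) | i <- iota 0 n] ++
  [seq Theta n (iter (p - n) Delta (genP p i)) | i <- iota 0 n].

End Covariants.

Arguments invariants : clear implicits.
Arguments covariants : clear implicits.
Arguments kVG : clear implicits.
Arguments kVWG : clear implicits.
Arguments kVG_plus : clear implicits.
Arguments algA : clear implicits.
Arguments generators : clear implicits.
Arguments Theta {k} n f.

(* Main.v *)
From HB Require Import structures.
Require Import Defs.
From mathcomp Require Import all_boot all_order all_algebra.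
From mathcomp Require Import zify ring.

(* Covariants are the [Theta f] with [Delta ^ n f = 0], so one has to show that
   [K_n = ker (Delta ^ n)] is spanned over [A] by the 2n given polynomials [g_i].

   Once [x3] is inverted, [x2 / x3] is a slice: the orbit polynomial
   [sigma ^ t f] in an indeterminate [t] turns [Delta] into the difference
   operator of [t], which lowers degrees by one except at multiples of p.  Hence
   elements of [K_n] have degree < n modulo p, and the [g_i] have exactly the
   degrees d < 2p with d mod p < n, with leading coefficients c x3^m.  As [a3]
   has degree 2p, division shows that [x3 ^ L * f] is in the [A]-span for large L.

   Modulo [x3], the leading terms in [x1] of the [g_i] are c x1^d x2^m where the
   pairs (d, m mod 2) are distinct and d < p, while [a2] and [a3] become x2^2 and
   x1^p - x1 x2^(p-1).  So the [g_i] stay independent modulo [x3], and the factor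
   [x3 ^ L] can be cancelled.  The same independence makes [a1, a2, a3] regular.

   Dimension and depth are at most 3 because four invariants are algebraically
   dependent over [k]: a relation, divided by powers of the successive elements,
   contradicts both a chain of primes (the elements being taken in the successive
   differences) and a regular sequence. *)

Set Implicit Arguments.
Unset Strict Implicit.
Unset Printing Implicit Defensive.

Import GRing.Theory.
Local Open Scope ring_scope.

(** * Multivariate polynomials and substitutions *)

Lemma mpoly_ring_ind n (R : comNzRingType) (P : {mpoly R[n]} -> Prop) :
    (forall c, P c%:MP) -> (forall i, P 'X_i) ->
    (forall p q, P p -> P q -> P (p + q)) ->
    (forall p q, P p -> P q -> P (p * q)) ->
  forall p, P p.
Proof.
move=> PC PX PD PM p; rewrite (mpolyE p).
apply: big_ind => [||m _]; [by rewrite -mpolyC0 | exact: (PD) |].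
rewrite -mul_mpolyC; apply: (PM) => //; rewrite mpolyXE_id.
apply: big_ind => [||i _]; [by rewrite -mpolyC1 | exact: (PM) |].
elim: (m i) => [|e IHe]; first by rewrite expr0 -mpolyC1.
by rewrite exprS; apply: PM.
Qed.

Lemma mpoly_rmorph_ext n (R : comNzRingType) (S : nzRingType)
    (u v : {rmorphism {mpoly R[n]} -> S}) :
    (forall c, u c%:MP = v c%:MP) -> (forall i, u 'X_i = v 'X_i) ->
  u =1 v.
Proof.
move=> uvC uvX p; elim/mpoly_ring_ind: p => // p q up uq.
  by rewrite !rmorphD up uq.
by rewrite !rmorphM up uq.
Qed.

(** Taken with [J] generated by some variables and [w] setting those to 0, it puts [p] in [J] as
    soon as that substitution kills [p]. *)
Lemma comp_mpoly_congr n m (R : comNzRingType) (J : {mpoly R[m]} -> Prop)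
    (v w : n.-tuple {mpoly R[m]}) (p : {mpoly R[n]}) :
  ideal J -> (forall i, J (tnth v i - tnth w i)) -> J ((p \mPo v) - (p \mPo w)).
Proof.
case=> J0 JD JM Jvw; elim/mpoly_ring_ind: p => [c|i|p q Jp Jq|p q Jp Jq].
- by rewrite !comp_mpolyC subrr.
- by rewrite !comp_mpolyXU -!tnth_nth.
- by rewrite !comp_mpolyD opprD addrACA; apply: JD.
- rewrite !rmorphM /=.
  have ->: (p \mPo v) * (q \mPo v) - (p \mPo w) * (q \mPo w) =
     (q \mPo v) * ((p \mPo v) - (p \mPo w)) + (p \mPo w) * ((q \mPo v) - (q \mPo w)).
    by ring.
  by apply: JD; apply: JM.
Qed.

(** * The difference operator on univariate polynomials *)

Section ShiftedPoly.

Variables (S : idomainType) (s : S).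
Implicit Type q : {poly S}.

Definition shift_diff q := q \Po ('X + s%:P) - q.

Lemma shift_diffD q r : shift_diff (q + r) = shift_diff q + shift_diff r.
Proof. by rewrite /shift_diff comp_polyD opprD addrACA. Qed.

Lemma shift_diffZ c q : shift_diff (c *: q) = c *: shift_diff q.
Proof. by rewrite /shift_diff comp_polyZ scalerBr. Qed.

Lemma size_shift_diff q : (size (shift_diff q) <= (size q).-1)%N.
Proof.
have [->|q0] := eqVneq q 0; first by rewrite /shift_diff comp_poly0 subr0 size_poly0.
have sq : size (q \Po ('X + s%:P)) = size q by rewrite size_comp_poly2 ?size_XaddC.
rewrite -ltnS prednK ?size_poly_gt0 // ltnNge; apply/negP => le_q.
have: (shift_diff q)`_(size q).-1 = 0.
  rewrite coefB -{1}sq -!lead_coefE lead_coef_comp ?size_XaddC //.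
  by rewrite lead_coefXaddC expr1n mulr1 subrr.
have eq_q : size (shift_diff q) = size q.
  apply/eqP; rewrite eqn_leq le_q andbT (leq_trans (size_polyD _ _)) //.
  by rewrite size_polyN sq maxnn.
rewrite -eq_q -lead_coefE => /eqP; rewrite lead_coef_eq0 => /eqP r0.
by move: eq_q; rewrite r0 size_poly0 => /esym/eqP; rewrite size_poly_eq0 (negPf q0).
Qed.

Lemma exprXaddC_lead e :
  (size (('X + s%:P)%R ^+ e.+1 - 'X^(e.+1) - (s *+ e.+1) *: 'X^e)%R <= e)%N.
Proof.
elim: e => [|e IHe].
  by rewrite !expr1 expr0 alg_polyC mulr1n addrAC addrK subrr size_poly0.
set r := (X in size (polyseq X)) in IHe.
have -> : ('X + s%:P) ^+ e.+2 - 'X^(e.+2) - (s *+ e.+2) *: 'X^(e.+1) =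
    (s * s *+ e.+1) *: 'X^e + r * ('X + s%:P).
  by rewrite -!mul_polyC /r exprSr ['X^(e.+2)]exprSr ['X^(e.+1)]exprSr
    -mul_polyC !polyCMn polyCM; ring.
rewrite (leq_trans (size_polyD _ _)) // geq_max; apply/andP; split.
  by rewrite (leq_trans (size_scale_leq _ _)) // size_polyXn.
by rewrite (leq_trans (size_polyMleq _ _)) // size_XaddC addn2.
Qed.

(** Only the top monomial matters: [(X + s)^e - X^e] starts with [e s X^(e-1)]. In characteristic p
    this term is lost when p divides [e]. *)
Lemma shift_diff_lead q e : s != 0 -> size q = e.+1 -> (e%:R : S) != 0 ->
  size (shift_diff q) = e /\ lead_coef (shift_diff q) = e%:R * s * lead_coef q.
Proof.
case: e => [|e] s0 sq; first by rewrite eqxx.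
move=> e0; set c := e.+1%:R * s * lead_coef q.
have c0 : c != 0 by rewrite !mulf_neq0 // lead_coef_eq0 -size_poly_eq0 sq.
have le_r : (size (shift_diff q - c *: 'X^e)%R <= e)%N.
  pose r := q - lead_coef q *: 'X^(e.+1).
  have sr : (size r <= e.+1)%N.
    apply/leq_sizeP => j; rewrite coefB coefZ coefXn /lead_coef sq.
    rewrite leq_eqVlt => /predU1P[<-|lt_j]; first by rewrite eqxx mulr1 subrr.
    by rewrite gtn_eqF // mulr0 subr0 nth_default ?sq.
  have -> : shift_diff q - c *: 'X^e =
     lead_coef q *: (('X + s%:P) ^+ e.+1 - 'X^(e.+1) - (s *+ e.+1) *: 'X^e)
     + shift_diff r.
    have {1}-> : q = lead_coef q *: 'X^(e.+1) + r by rewrite /r addrC subrK.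
    rewrite shift_diffD shift_diffZ [shift_diff 'X^_]/shift_diff comp_Xn_poly.
    rewrite [LHS]addrAC [in RHS]scalerBr; congr (_ - _ + _).
    by rewrite scalerA /c mulr_natl mulrC.
  rewrite (leq_trans (size_polyD _ _)) // geq_max; apply/andP; split.
    by rewrite (leq_trans (size_scale_leq _ _)) // exprXaddC_lead.
  by rewrite (leq_trans (size_shift_diff _)) // -subn1 leq_subLR.
have -> : shift_diff q = c *: 'X^e + (shift_diff q - c *: 'X^e) by rewrite addrC subrK.
have sX : size (c *: 'X^e) = e.+1 by rewrite size_scale // size_polyXn.
by rewrite size_polyDl ?lead_coefDl ?sX ?ltnS // lead_coefZ lead_coefXn mulr1.
Qed.

End ShiftedPoly.

Section Basics.
Variable k : fieldType.
Implicit Types f g : kV k.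

Lemma sigmaX1 : sigma (x1 k) = x1 k + x2 k.
Proof. by rewrite /sigma comp_mpolyXU. Qed.
Lemma sigmaX2 : sigma (x2 k) = x2 k + x3 k.
Proof. by rewrite /sigma comp_mpolyXU. Qed.
Lemma sigmaX3 : sigma (x3 k) = x3 k.
Proof. by rewrite /sigma comp_mpolyXU. Qed.
Lemma sigmaC c : sigma c%:MP = c%:MP :> kV k.
Proof. by rewrite /sigma comp_mpolyC. Qed.

Section Eval3.
Variables (S : comNzRingType) (h : {rmorphism k -> S}) (u : 3.-tuple S).
Definition ev3 : kV k -> S := mmap h (tnth u).
HB.instance Definition _ := GRing.RMorphism.copy ev3 (mmap h (tnth u)).
Lemma ev3C c : ev3 c%:MP = h c. Proof. exact: mmapC. Qed.
Lemma ev3X i : ev3 'X_i = u`_i.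
Proof. by rewrite /ev3 mmapX mmap1U (tnth_nth 0). Qed.
End Eval3.

Lemma kV_ext (S : nzRingType) (u v : {rmorphism kV k -> S}) :
    (forall c, u c%:MP = v c%:MP) -> u (x1 k) = v (x1 k) ->
    u (x2 k) = v (x2 k) -> u (x3 k) = v (x3 k) ->
  u =1 v.
Proof.
move=> uvC uv1 uv2 uv3; apply: mpoly_rmorph_ext => // i.
by case: i => [[|[|[|//]]] lt_i]; rewrite (bool_irrelevance lt_i isT).
Qed.

End Basics.

(** * Leading coefficients in the orbit variable *)

Section LeadingForms.

Variables (k : fieldType) (p : nat) (S : idomainType) (h : {rmorphism k -> S}).
Variables (z : S) (r : nat).
Hypotheses (char_k : p \in [pchar k]) (z_neq0 : z != 0).
Implicit Type q : {poly S}.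

(** The exponent [m] is recorded because its parity tells generators apart modulo [x3]. *)
Definition lead_form q e m :=
  size q = e.+1 /\ exists2 c : k, c != 0 & lead_coef q = h c * z ^+ m.

Lemma lead_form_neq0 q e m : lead_form q e m -> q != 0.
Proof. by case=> sq _; rewrite -size_poly_eq0 sq. Qed.

Lemma lead_formM q1 q2 e1 e2 m1 m2 : lead_form q1 e1 m1 -> lead_form q2 e2 m2 ->
  lead_form (q1 * q2) (e1 + e2) (m1 + m2).
Proof.
move=> l1 l2; split.
  rewrite size_mul ?(lead_form_neq0 l1) ?(lead_form_neq0 l2) //.
  by case: l1 l2 => [-> _] [-> _]; rewrite addSn addnS.
case: l1 l2 => [_ [c1 c10 e_1]] [_ [c2 c20 e_2]].
exists (c1 * c2); first by rewrite mulf_neq0.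
by rewrite lead_coefM e_1 e_2 rmorphM exprD mulrACA.
Qed.

Lemma lead_form1 : lead_form 1 0 0.
Proof.
split; first by rewrite size_poly1.
by exists 1; rewrite ?oner_eq0 // lead_coef1 rmorph1 mulr1.
Qed.

Lemma lead_formX q e m a : lead_form q e m -> lead_form (q ^+ a) (a * e) (a * m).
Proof.
move=> l; elim: a => [|a IHa]; first exact: lead_form1.
by rewrite exprS !mulSn; apply: lead_formM.
Qed.

Lemma lead_form_shift q e m : (e %% p)%N != 0%N -> lead_form q e m ->
  lead_form (shift_diff (z ^+ r) q) e.-1 (m + r).
Proof.
move=> ep [sq [c c0 lq]].
have hn i : h i%:R = i%:R by rewrite rmorph_nat.
have e0 : (e%:R : k) != 0 by rewrite -(dvdn_pcharf char_k).
have e0' : (e%:R : S) != 0 by rewrite -hn fmorph_eq0.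
have [sd lc] := shift_diff_lead (expf_neq0 r z_neq0) sq e0'.
split; first by rewrite sd; case: e ep {sq e0 e0' lc sd} => //; rewrite mod0n.
exists (e%:R * c); first by rewrite mulf_neq0.
by rewrite lc lq rmorphM hn exprD; ring.
Qed.

(** The bound on [j] keeps the degrees [e, ..., e - j + 1] away from multiples of p, so no scalar
    factor vanishes. *)
Lemma lead_form_iter q e m j : (j <= e %% p)%N -> lead_form q e m ->
  lead_form (iter j (shift_diff (z ^+ r)) q) (e - j) (m + j * r).
Proof.
move=> + lq; elim: j => [|j IHj] le_j; first by rewrite subn0 addn0.
rewrite iterS mulSn [(r + _)%N]addnC addnA subnS; apply: lead_form_shift.
  have le_e := leq_mod e p.
  rewrite (divn_eq e p) -addnBA 1?ltnW // modnMDl modn_small ?subn_eq0 -?ltnNge //.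
  by rewrite (leq_ltn_trans (leq_subr _ _)) // ltn_pmod // prime_gt0 ?(pcharf_prime char_k).
exact/IHj/ltnW.
Qed.

End LeadingForms.

(** * The 2n generators and their degrees *)

Section Generators.

Variables (k : fieldType) (p n : nat).

(* [Theta] maps [gen 0], ..., [gen (2n - 1)] to the listed generators. *)
Definition gen (i : nat) : kV k :=
  if (i < n)%N then genM k i else iter (p - n) (@Delta k) (genP k p (i - n)).

Section Rho.

Hypotheses (p_prime : prime p) (p_odd : odd p) (char_k : p \in [pchar k]).
Hypotheses (n_ge1 : (1 <= n)%N) (n_le_p : (n <= p)%N).
Variables (S : idomainType) (h : {rmorphism k -> S}) (z : S) (r : nat).
Hypothesis z_neq0 : z != 0.
Variable rho : {rmorphism kV k -> {poly S}}.
Hypothesis rho_sigma : forall f, rho (sigma f) = rho f \Po ('X + (z ^+ r)%:P).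

Lemma rho_Delta f : rho (Delta f) = shift_diff (z ^+ r) (rho f).
Proof. by rewrite /Delta rmorphB /= rho_sigma. Qed.

Lemma rho_iter_Delta f j :
  rho (iter j (@Delta k) f) = iter j (shift_diff (z ^+ r)) (rho f).
Proof. by elim: j => //= j IHj; rewrite rho_Delta IHj. Qed.

Variables e1 m1 e2 m2 : nat.
Hypothesis rho_x1 : lead_form h z (rho (x1 k)) e1 m1.
Hypothesis rho_x2 : lead_form h z (rho (x2 k)) e2 m2.

(** Generators are iterated differences of monomials. This serves for [psi] ([r = 0], [z = x3]) and
    for reduction modulo [x3] ([r = 1], [z] the image of [x2]). *)
Lemma rho_monomial a b j : (j <= (a * e1 + b * e2) %% p)%N ->
  lead_form h z (rho (iter j (@Delta k) (x1 k ^+ a * x2 k ^+ b)))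
    (a * e1 + b * e2 - j) (a * m1 + b * m2 + j * r).
Proof.
move=> le_j; rewrite rho_iter_Delta; apply: (lead_form_iter _ char_k) => //.
by rewrite rmorphM !rmorphXn; apply: lead_formM; apply: lead_formX.
Qed.

End Rho.

End Generators.

Section GeneratorExponents.

Variables p n : nat.
Hypotheses (p_odd : odd p) (n_ge1 : (1 <= n)%N) (n_le_p : (n <= p)%N).

(** [gen i] is [Delta^D (x1^a x2^b)] with [a], [b], [D] given by the next three functions; the extra
    [Delta] in P at even positive indices is counted in [D]. *)
Definition gen_expx1 (i : nat) : nat :=
  if (i < n)%N then i./2 else
  if i == n then p.-1 else
  (if odd (i - n) then p - (i - n).+1./2 else p - (i - n)./2)%N.

Definition gen_expx2 (i : nat) : nat :=
  if (i < n)%N then odd i else i == n.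

Definition gen_expD (i : nat) : nat :=
  if (i < n)%N then 0 else
  (if (i == n) || odd (i - n) then p - n else (p - n).+1)%N.

(** The degree in t, where [x1] has degree 2 and [x2] degree 1: it takes the values 0, ..., n-1,
    then p+n-1 down to p. *)
Definition gen_tdeg (i : nat) : nat := if (i < n)%N then i else (p + n + n - i.+1)%N.

Lemma gen_tdegP i : (i < n + n)%N ->
  (gen_expD i <= (gen_expx1 i * 2 + gen_expx2 i * 1) %% p)%N /\
  (gen_expx1 i * 2 + gen_expx2 i * 1 - gen_expD i = gen_tdeg i)%N.
Proof.
move=> lt_i; rewrite /gen_expD /gen_expx1 /gen_expx2 /gen_tdeg.
have p0 : (0 < p)%N by lia.
case: ltnP => [_|le_ni]; first by split=> //; lia.
suff E : exists s, [/\ (s < p)%N, 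
   ((if i == n then p.-1 else
     if odd (i - n) then p - (i - n).+1./2 else p - (i - n)./2) * 2 +
    (i == n) * 1 = p + s)%N,
   ((if (i == n) || odd (i - n) then p - n else (p - n).+1) <= s)%N &
   (p + s - (if (i == n) || odd (i - n) then p - n else (p - n).+1) =
    p + n + n - i.+1)%N].
  by case: E => s [lt_s -> le_s ->]; rewrite modnDl modn_small.
(* The degree of the monomial minus p; halving makes even positive indices differ by one. *)
exists (p - 1 - (i - n) + (~~ (odd (i - n)) && (i != n)))%N.
case: (i =P n) => [->|ne_in] /=; first by split; lia.
by case: ifP => odd_i; split; lia.
Qed.

(** The degree in [x1] modulo [x3], where each [Delta] trades one [x1] for one [x2]. *)
Definition gen_xdeg (i : nat) : nat := if (i < n)%N then i./2 else (n.-1 - (i - n)./2)%N.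

Lemma gen_xdegP i : (i < n + n)%N ->
  [/\ (gen_expD i <= (gen_expx1 i * 1 + gen_expx2 i * 0) %% p)%N,
   (gen_expx1 i * 1 + gen_expx2 i * 0 - gen_expD i = gen_xdeg i)%N &
    odd (gen_expx1 i * 0 + gen_expx2 i * 1 + gen_expD i * 1) = odd i].
Proof.
move=> lt_i; rewrite /gen_expD /gen_expx1 /gen_expx2 /gen_xdeg !muln0 !muln1 addn0 add0n.
have p0 : (0 < p)%N by lia.
case: ltnP => [_|le_ni]; first by split=> //; rewrite ?addn0 ?subn0 ?oddb.
case: (i =P n) => [->|ne_in] /=.
  by split; rewrite ?modn_small; lia.
by case: ifP => odd_i; split; rewrite ?modn_small; lia.
Qed.

(* Each pair [(d, e)] with [d < n] and [e] a parity is the key of one generator. *)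
Lemma gen_key_inj i j : (i < n + n)%N -> (j < n + n)%N ->
  gen_xdeg i = gen_xdeg j %[mod p] -> odd i = odd j -> i = j.
Proof.
move=> lt_i lt_j; rewrite /gen_xdeg.
case: (ltnP i n) => hi; case: (ltnP j n) => hj; rewrite !modn_small; lia.
Qed.

(** [p * 2] is the degree of [a3] in t. The parity of the quotient of [d] by p selects the block 0,
    ..., n-1 or p, ..., p+n-1; half the quotient counts factors [a3]. *)
Lemma gen_tdeg_surj d : (d %% p < n)%N ->
  exists i a, (i < n + n)%N /\ d = (gen_tdeg i + a * (p * 2))%N.
Proof.
move=> lt_d.
have p0 : (0 < p)%N by lia.
have e1 := divn_eq d p; have e2 := odd_double_half (d %/ p).
rewrite /gen_tdeg.
case: (boolP (odd (d %/ p))) e2 => _ e2.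
  exists (n + n - (d %% p).+1)%N, ((d %/ p)./2); split; first by lia.
  rewrite ifF; last by lia.
  rewrite {1}e1 -{1}e2 -muln2; nia.
exists (d %% p)%N, ((d %/ p)./2); split; first by lia.
rewrite lt_d {1}e1 -{1}e2 -muln2; nia.
Qed.

End GeneratorExponents.

Section GeneratorDegrees.

Variables (k : fieldType) (p n : nat).
Hypotheses (p_prime : prime p) (p_odd : odd p) (char_k : p \in [pchar k]).
Hypotheses (n_ge1 : (1 <= n)%N) (n_le_p : (n <= p)%N).

Lemma genE i : gen k p n i = 
  iter (gen_expD p n i) (@Delta k) (x1 k ^+ gen_expx1 p n i * x2 k ^+ gen_expx2 n i).
Proof.
rewrite /gen /gen_expD /gen_expx1 /gen_expx2 /genM /genP.
case: ltnP => [_|le_ni].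
  case: ifP => [odd_i|_]; last by rewrite mulr1.
  by congr (_ ^+ _ * _); case: i odd_i => //= i /negPf oi; rewrite uphalf_half oi.
have -> : (i - n == 0)%N = (i == n) by rewrite subn_eq0 eqn_leq le_ni andbT.
case: eqP => [//|_] /=; rewrite mulr1; case: ifP => // _.
by rewrite -iterSr.
Qed.

(* [psi f] is [sigma ^ t f], with [t] an indeterminate. *)
Definition psi : kV k -> {poly kV k} :=
  ev3 (polyC \o @mpolyC 3 k)
    [tuple (x1 k)%:P + x2 k *: 'X + (2%:R^-1 *: x3 k) *: ('X^2 - 'X);
           (x2 k)%:P + x3 k *: 'X; (x3 k)%:P].
HB.instance Definition _ := GRing.RMorphism.on psi.

Lemma psiC c : psi c%:MP = (c%:MP)%:P. Proof. exact: ev3C. Qed.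
Lemma psi1 : psi (x1 k) = (x1 k)%:P + x2 k *: 'X + (2%:R^-1 *: x3 k) *: ('X^2 - 'X).
Proof. exact: ev3X. Qed.
Lemma psi2 : psi (x2 k) = (x2 k)%:P + x3 k *: 'X.
Proof. exact: ev3X. Qed.
Lemma psi3 : psi (x3 k) = (x3 k)%:P.
Proof. exact: ev3X. Qed.

#[global] Opaque psi.

Lemma two_neq0 : (2%:R : k) != 0.
Proof.
rewrite -(dvdn_pcharf char_k); apply/negP => /dvdn_leq => /(_ isT).
by case: (p) p_odd p_prime => [|[|[|]]].
Qed.

Lemma x_neq0 i : ('X_i : kV k) != 0.
Proof.
apply/negP => /eqP /mpolyP /(_ U_(i)%MM) /eqP.
by rewrite mcoeffX eqxx mcoeff0 oner_eq0.
Qed.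

Lemma psi_sigma f : psi (sigma f) = psi f \Po ('X + 1%:P).
Proof.
apply: (@kV_ext k _ (psi \o @sigma k) (comp_poly ('X + 1%:P) \o psi)) => /=.
- by move=> c; rewrite sigmaC psiC comp_polyC.
- rewrite sigmaX1 rmorphD /= psi1 psi2.
  rewrite !comp_polyD !comp_polyZ comp_polyB comp_Xn_poly comp_polyX comp_polyC.
  have {2}-> : x3 k = (2%:R^-1 *: x3 k) *+ 2.
    by rewrite -scaler_nat scalerA divff ?two_neq0 ?scale1r.
  by rewrite -!mul_polyC polyCMn; ring.
- by rewrite sigmaX2 rmorphD /= psi2 psi3 comp_polyD comp_polyZ !comp_polyC comp_polyX
    scalerDr alg_polyC addrA addrAC.
- by rewrite sigmaX3 psi3 comp_polyC.
Qed.

Lemma psi_at0 f : (psi f).[0] = f.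
Proof.
apply: (@kV_ext k _ (horner_eval 0 \o psi) idfun) => /= [c|||]; rewrite /horner_eval /=.
- by rewrite psiC hornerC.
- by rewrite psi1 !hornerE expr0n subrr mulr0 addr0.
- by rewrite psi2 !hornerE.
- by rewrite psi3 hornerC.
Qed.

Lemma psi_inj : injective psi.
Proof. by move=> f g fg; rewrite -(psi_at0 f) fg psi_at0. Qed.

Lemma psi_iter_sigma f i : psi (iter i (@sigma k) f) = psi f \Po ('X + i%:R%:P).
Proof.
elim: i => [|i IHi]; first by rewrite addr0 comp_polyXr.
rewrite iterS psi_sigma IHi.
apply: (etrans (esym (comp_polyA (psi f) _ _))); congr (_ \Po _).
rewrite comp_polyD comp_polyX comp_polyC -addrA -polyCD.
by rewrite [1 + _]addrC natr1.
Qed.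

Lemma lead_psi1 : lead_form (@mpolyC 3 k) (x3 k) (psi (x1 k)) 2 1.
Proof.
have c0 : (2%:R^-1 *: x3 k) != 0 by rewrite scaler_eq0 invr_eq0 negb_or two_neq0 x_neq0.
have -> : psi (x1 k) = (2%:R^-1 *: x3 k) *: 'X^2 + ((x1 k)%:P + (x2 k - 2%:R^-1 *: x3 k) *: 'X).
  by rewrite psi1 scalerBr scalerBl addrC -addrA; congr (_ + _); rewrite addrCA [- _ + _]addrC.
have s2 : (size ((2%:R^-1 *: x3 k) *: 'X^2)%R = 3)%N by rewrite size_scale // size_polyXn.
have lt_s : (size ((x1 k)%:P + (x2 k - 2%:R^-1 *: x3 k) *: 'X)%R < 3)%N.
  rewrite (leq_ltn_trans (size_polyD _ _)) // gtn_max !ltnS.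
  rewrite (leq_trans (size_polyC_leq1 _)) //=.
  by rewrite (leq_trans (size_scale_leq _ _)) // size_polyX.
split; first by rewrite size_polyDl s2.
exists (2%:R^-1); first by rewrite invr_eq0 two_neq0.
by rewrite lead_coefDl ?s2 // lead_coefZ lead_coefXn mulr1 mul_mpolyC.
Qed.

Lemma lead_psi2 : lead_form (@mpolyC 3 k) (x3 k) (psi (x2 k)) 1 1.
Proof.
have s2 : (size (x3 k *: 'X)%R = 2)%N by rewrite size_scale ?x_neq0 // size_polyX.
have lt_s : (size ((x2 k)%:P)%R < 2)%N by rewrite ltnS size_polyC_leq1.
rewrite psi2 addrC; split; first by rewrite size_polyDl s2.
exists 1; first by rewrite oner_eq0.
by rewrite lead_coefDl ?s2 // lead_coefZ lead_coefX mulr1 mul1r.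
Qed.

Lemma lead_psi_gen i : (i < n + n)%N ->
  exists m, lead_form (@mpolyC 3 k) (x3 k) (psi (gen k p n i)) (gen_tdeg p n i) m.
Proof.
case/(gen_tdegP p_odd n_ge1 n_le_p) => le_c <-; rewrite genE; eexists.
(* [r = 0] makes the shift [z ^ r] equal to 1, as in [psi_sigma]. *)
apply: (rho_monomial (r := 0) char_k (x_neq0 _) _ lead_psi1 lead_psi2 le_c).
exact: psi_sigma.
Qed.

(** [a3] is a product of p translates of [x1]; translating t changes neither the degree 2 of
    [psi x1] nor its leading coefficient [x3 / 2]. *)
Lemma lead_psi_a3 : exists m, lead_form (@mpolyC 3 k) (x3 k) (psi (a3 k p)) (p * 2) m.
Proof.
exists (p * 1)%N; rewrite /a3 rmorph_prod.
have -> : \prod_(i < p) psi (iter i (@sigma k) (x1 k)) =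
    \prod_(i < p) (psi (x1 k) \Po ('X + i%:R%:P)).
  by apply: eq_bigr => i _; apply: psi_iter_sigma.
have l i : lead_form (@mpolyC 3 k) (x3 k) (psi (x1 k) \Po ('X + i%:R%:P)) 2 1.
  have [s2 [c c0 lc]] := lead_psi1; split; first by rewrite size_comp_poly2 // size_XaddC.
  exists c => //; rewrite lead_coef_comp ?size_XaddC //.
  by rewrite lead_coefXaddC expr1n mulr1.
have: forall q, lead_form (@mpolyC 3 k) (x3 k)
    (\prod_(i < q) (psi (x1 k) \Po ('X + i%:R%:P))) (q * 2) (q * 1).
  elim=> [|q IHq]; first by rewrite big_ord0; apply: lead_form1.
  by rewrite big_ord_recr /= mulSn mulSn addnC [(1 + _)%N]addnC; apply: lead_formM.
exact.
Qed.

End GeneratorDegrees.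

(** One division step without inverting [x]: crosswise multiplication makes the leading terms
    agree. *)
Lemma size_lead_cancel (S : comNzRingType) (u v : {poly S}) (b c x : S) L m N :
    size u = N.+1 -> size v = N.+1 ->
    x ^+ L * lead_coef u = b -> lead_coef v = c * x ^+ m ->
  (size ((c * x ^+ (L + m)) *: u - b *: v)%R <= N)%N.
Proof.
move=> su sv <- e; apply/leq_sizeP => j.
rewrite leq_eqVlt coefB !coefZ => /predU1P[<-|lt_j].
  move: e; rewrite /lead_coef su sv /= => ->.
  by apply/eqP; rewrite subr_eq0 exprD; apply/eqP; ring.
by rewrite !nth_default ?su ?sv // !mulr0 subrr.
Qed.

(** * Spanning after multiplication by a power of [x3] *)

Section Span.

Variables (k : fieldType) (p n : nat).

(** The image is [A]. In arguments of [evalA], the names [x1], [x2], [x3] are formal variables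
    standing for [a1], [a2], [a3]; thus [evalA (x1 k)] is [x3 k]. *)
Definition evalA (P : kV k) : kV k := P \mPo [tuple a1 k; a2 k; a3 k p].
HB.instance Definition _ := GRing.RMorphism.copy evalA
  (comp_mpoly [tuple a1 k; a2 k; a3 k p]).

Lemma evalAC c : evalA c%:MP = c%:MP.
Proof. exact: comp_mpolyC. Qed.
Lemma evalA1 : evalA (x1 k) = x3 k.
Proof. exact: comp_mpolyXU. Qed.
Lemma evalA2 : evalA (x2 k) = a2 k.
Proof. exact: comp_mpolyXU. Qed.
Lemma evalA3 : evalA (x3 k) = a3 k p.
Proof. exact: comp_mpolyXU. Qed.

#[global] Opaque evalA.

Definition gen_span (f : kV k) :=
  exists c : 'I_(n + n) -> kV k, f = \sum_(i < n + n) evalA (c i) * gen k p n i.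

Lemma gen_spanD f g : gen_span f -> gen_span g -> gen_span (f + g).
Proof.
move=> [c ->] [d ->]; exists (fun i => c i + d i); rewrite -big_split.
by apply: eq_bigr => i _; rewrite rmorphD mulrDl.
Qed.

Lemma gen_spanM P f : gen_span f -> gen_span (evalA P * f).
Proof.
move=> [c ->]; exists (fun i => P * c i); rewrite mulr_sumr.
by apply: eq_bigr => i _; rewrite rmorphM mulrA.
Qed.

Lemma gen_span_gen i : (i < n + n)%N -> gen_span (gen k p n i).
Proof.
move=> lt_i; exists (fun j => (j == Ordinal lt_i)%:R).
rewrite (bigD1 (Ordinal lt_i)) //= eqxx rmorph1 mul1r big1 ?addr0 // => j ne_j.
by rewrite (negPf ne_j) rmorph0 mul0r.
Qed.

Lemma gen_span0 : gen_span 0.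
Proof. by exists (fun=> 0); rewrite big1 // => i _; rewrite rmorph0 mul0r. Qed.

Section DeltaLinear.

Implicit Types f g : kV k.

Lemma Delta_iterB j f g :
  iter j (@Delta k) (f - g) = iter j (@Delta k) f - iter j (@Delta k) g.
Proof.
by elim: j => //= j ->; rewrite /Delta rmorphB /=; ring.
Qed.

Lemma Delta_iterD j f g :
  iter j (@Delta k) (f + g) = iter j (@Delta k) f + iter j (@Delta k) g.
Proof. by elim: j => //= j ->; rewrite /Delta rmorphD /=; ring. Qed.

Lemma Delta_iterM j a f : sigma a = a ->
  iter j (@Delta k) (a * f) = a * iter j (@Delta k) f.
Proof. by move=> sa; elim: j => //= j ->; rewrite /Delta rmorphM /= sa mulrBr. Qed.

Lemma Delta_iter_sum j (I : finType) (F : I -> kV k) :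
  iter j (@Delta k) (\sum_i F i) = \sum_i iter j (@Delta k) (F i).
Proof.
apply: big_morph => [f g|]; first exact: Delta_iterD.
by elim: j => //= j ->; rewrite /Delta rmorph0 subrr.
Qed.

(* [sigma = 1 + Delta], expanded by the binomial theorem. *)
Lemma iter_sigma_Delta m N f : (m < N)%N ->
  iter m (@sigma k) f = \sum_(j < N) iter j (@Delta k) f *+ 'C(m, j).
Proof.
elim: m N => [|m IHm] [|N] // lt_mN.
  by rewrite big_ord_recl bin0 big1 ?addr0.
rewrite iterS (IHm N) //.
set S := \sum_(j < N) _.
have -> : sigma S = S + Delta S by rewrite /Delta addrC subrK.
rewrite [RHS]big_ord_recl bin0.
have -> : \sum_(i < N) iter (bump 0 i) (@Delta k) f *+ 'C(m.+1, bump 0 i) =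
   \sum_(i < N) iter i.+1 (@Delta k) f *+ 'C(m, i.+1) +
   Delta S.
  rewrite -[Delta _]/(iter 1 (@Delta k) _) Delta_iter_sum -big_split.
  apply: eq_bigr => i _; rewrite /bump add1n binS mulrnDr; congr (_ + _).
  by rewrite /= /Delta rmorphMn mulrnBl.
rewrite [RHS]addrA; congr (_ + _).
by rewrite -[LHS](IHm N) // (IHm N.+1) ?leqW // big_ord_recl bin0.
Qed.

End DeltaLinear.

Hypotheses (p_prime : prime p) (p_odd : odd p) (char_k : p \in [pchar k]).
Hypotheses (n_ge1 : (1 <= n)%N) (n_le_p : (n <= p)%N).

Lemma sigma_orderp f : iter p (@sigma k) f = f.
Proof.
apply: (@psi_inj k); rewrite (psi_iter_sigma p_prime p_odd char_k).
have -> : (p%:R : kV k) = 0.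
  by rewrite -(rmorph_nat (@mpolyC 3 k)) /= (pcharf0 char_k) mpolyC0.
by rewrite addr0 comp_polyXr.
Qed.

(** When [sigma^p = 1] is expanded in powers of [Delta], the middle binomials vanish modulo p, which
    leaves [f = f + Delta^p f]. *)
Lemma Delta_iterp f : iter p (@Delta k) f = 0.
Proof.
have := iter_sigma_Delta f (ltnSn p); rewrite sigma_orderp big_ord_recr /= binn.
have := prime_gt0 p_prime; case Dp: p => [//|p'] _.
rewrite big_ord_recl bin0 /= big1 => [|i _].
  by rewrite addr0 !mulr1n => /esym/(canRL (addKr _)); rewrite addNr.
have : (p %| 'C(p, bump 0 i))%N.
  by apply: prime_dvd_bin => //; rewrite Dp /bump /=; case: i.
case/dvdnP=> b; rewrite Dp => ->; rewrite -Dp mulrnA.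
rewrite -[in X in X = _]mulr_natr -(rmorph_nat (@mpolyC 3 k)) /=.
by rewrite (pcharf0 char_k) mpolyC0 mulr0.
Qed.

Lemma sigma_a2 : sigma (a2 k) = a2 k.
Proof.
rewrite /a2 !(rmorphB, rmorphM, rmorphXn) /= rmorph_nat sigmaX1 sigmaX2 sigmaX3.
by ring.
Qed.

Lemma sigma_a3 : sigma (a3 k p) = a3 k p.
Proof.
rewrite /a3 rmorph_prod /=; have := prime_gt0 p_prime; have := sigma_orderp (x1 k).
case: (p) => [//|q] sp _.
rewrite big_ord_recr /= -iterS sp [RHS]big_ord_recl mulrC.
by congr (_ * _); apply: eq_bigr => i _; rewrite -iterS.
Qed.

Lemma sigma_evalA P : sigma (evalA P) = evalA P.
Proof.
apply: (@kV_ext k _ (@sigma k \o evalA) evalA) => [c|||] /=.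
- by rewrite evalAC sigmaC.
- by rewrite evalA1 sigmaX3.
- by rewrite evalA2 sigma_a2.
- by rewrite evalA3 sigma_a3.
Qed.

Lemma psi_iter_Delta f j : psi (iter j (@Delta k) f) = iter j (shift_diff 1) (psi f).
Proof.
elim: j => //= j <-; rewrite {1}/Delta rmorphB /=.
by rewrite (psi_sigma p_prime p_odd char_k).
Qed.

(** The last n generators are images of [Delta^(p-n)], and [Delta^p = 0]; the first n have degree
    below n in t. *)
Lemma Delta_iter_gen i : (i < n + n)%N -> iter n (@Delta k) (gen k p n i) = 0.
Proof.
move=> lt_i; rewrite /gen; case: ltnP => lt_in; last first.
  by rewrite -iterD subnKC // Delta_iterp.
have [m [sg _]] := lead_psi_gen p_prime p_odd char_k n_ge1 n_le_p lt_i.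
rewrite /gen /gen_tdeg lt_in in sg.
apply: (@psi_inj k); rewrite psi_iter_Delta rmorph0; apply/eqP.
have le_s j : (size (iter j (shift_diff 1) (psi (genM k i))) <= i.+1 - j)%N.
  elim: j => [|j IHj]; first by rewrite sg subn0.
  by rewrite iterS (leq_trans (size_shift_diff _ _)) // subnS -!subn1 leq_sub2r.
by rewrite -size_poly_eq0 -leqn0 (leq_trans (le_s n)) // leqn0 subn_eq0.
Qed.

Lemma Delta_iter_gen_span f : gen_span f -> iter n (@Delta k) f = 0.
Proof.
move=> [c ->]; rewrite Delta_iter_sum big1 // => i _.
by rewrite Delta_iterM ?sigma_evalA // Delta_iter_gen // mulr0.
Qed.

(* The elements of [k[a1, a2]] belong to this ring; unlike [a3], they do not
   involve [t] after applying [psi]. *)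
Definition orbit_const c := (exists P, c = evalA P) /\ psi c = c%:P.

Lemma orbit_constC c : orbit_const c%:MP.
Proof. by split; [exists c%:MP; rewrite evalAC | rewrite psiC]. Qed.

Lemma orbit_constD c d : orbit_const c -> orbit_const d -> orbit_const (c + d).
Proof.
move=> [[P ->] ec] [[Q ->] ed]; split; first by exists (P + Q); rewrite rmorphD.
by rewrite rmorphD /= ec ed rmorphD.
Qed.

Lemma orbit_constM c d : orbit_const c -> orbit_const d -> orbit_const (c * d).
Proof.
move=> [[P ->] ec] [[Q ->] ed]; split; first by exists (P * Q); rewrite rmorphM.
by rewrite rmorphM /= ec ed rmorphM.
Qed.

Lemma orbit_constN c : orbit_const c -> orbit_const (- c).
Proof. by move=> oc; rewrite -mulN1r -mpolyC1 -mpolyCN; apply/orbit_constM/oc/orbit_constC. Qed.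

Lemma orbit_const_x3 : orbit_const (x3 k).
Proof. by split; [exists (x1 k); rewrite evalA1 | rewrite psi3]. Qed.

Lemma orbit_const_a2 : orbit_const (a2 k).
Proof.
split; first by exists (x2 k); rewrite evalA2.
rewrite /a2 !(rmorphB, rmorphM, rmorphXn) /= rmorph_nat psi1 psi2 psi3.
have e : x3 k = (2%:R^-1 *: x3 k) *+ 2.
  by rewrite -scaler_nat scalerA divff ?scale1r // (two_neq0 p_prime p_odd char_k).
rewrite -!mul_polyC; set y := 2%:R^-1 *: x3 k in e *.
by rewrite e !polyCMn; ring.
Qed.

Lemma orbit_constX c j : orbit_const c -> orbit_const (c ^+ j).
Proof.
move=> oc; elim: j => [|j IHj]; first by rewrite expr0 -mpolyC1; apply: orbit_constC.
by rewrite exprS; apply: orbit_constM.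
Qed.

Lemma orbit_const_sum (I : Type) (s : seq I) (F : I -> kV k) :
  (forall i, orbit_const (F i)) -> orbit_const (\sum_(i <- s) F i).
Proof.
move=> oF; apply: big_ind => //; last exact: orbit_constD.
by rewrite -mpolyC0; apply: orbit_constC.
Qed.

(** Once [x3] is inverted, [2 x1 x3 = x2^2 - x2 x3 - a2] makes [x1] a polynomial in [x2] over
    [k[a1, a2]]. *)
Lemma orbit_poly_repr f : exists L (q : {poly kV k}),
  (forall i, orbit_const q`_i) /\ x3 k ^+ L * f = q.[x2 k].
Proof.
have oP (q : {poly kV k}) (s : seq (kV k)) :
    (forall i, orbit_const s`_i) -> q = Poly s -> forall i, orbit_const q`_i.
  by move=> os -> i; rewrite coef_Poly.
have o0 : orbit_const 0 by rewrite -mpolyC0; apply: orbit_constC.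
have o1 : orbit_const 1 by rewrite -mpolyC1; apply: orbit_constC.
elim/mpoly_ring_ind: f => [c|i|f g|f g].
- exists 0%N, c%:MP%:P; rewrite mul1r hornerC; split=> // i.
  by rewrite coefC; case: ifP => // _; apply: orbit_constC.
- have [|[]] : 'X_i = x1 k \/ 'X_i = x2 k \/ 'X_i = x3 k.
  + by case: i => [[|[|[|//]]] lt_i]; rewrite (bool_irrelevance lt_i isT); auto.
  + move=> ->; exists 1%N, (2%:R^-1%:MP%:P * ('X^2 - x3 k *: 'X - (a2 k)%:P)).
    split=> [j|].
      rewrite coefCM !coefB coefXn coefZ coefX coefC.
      apply: orbit_constM; first exact: orbit_constC.
      apply: orbit_constD; last by apply: orbit_constN; case: ifP => // _; apply: orbit_const_a2.
      apply: orbit_constD; first by case: eqP.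
      apply: orbit_constN; apply: orbit_constM; first exact: orbit_const_x3.
      by case: eqP.
    rewrite !hornerE /= mul_mpolyC.
    apply: (canRL (scalerK _)); first by rewrite (two_neq0 p_prime p_odd char_k).
    by rewrite /a2 scaler_nat; ring.
  + move=> ->; exists 0%N, 'X; rewrite mul1r hornerX; split=> // j.
    by rewrite coefX; case: eqP.
  + move=> ->; exists 0%N, (x3 k)%:P; rewrite mul1r hornerC; split=> // j.
    by rewrite coefC; case: ifP => // _; apply: orbit_const_x3.
- move=> [L [q [oq eq]]] [L' [q' [oq' eq']]]; exists (L + L')%N, (x3 k ^+ L' *: q + x3 k ^+ L *: q').
  split=> [j|]; last by rewrite hornerD !hornerZ -eq -eq' exprD; ring.
  rewrite coefD !coefZ.
  by apply: orbit_constD; apply: orbit_constM => //; apply: orbit_constX orbit_const_x3.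
- move=> [L [q [oq eq]]] [L' [q' [oq' eq']]]; exists (L + L')%N, (q * q').
  split=> [j|]; last by rewrite hornerM -eq -eq' exprD; ring.
  by rewrite coefM; apply: orbit_const_sum => i; apply: orbit_constM.
Qed.

(** Under [psi] the coefficients of the preceding [q] stay constant in t and [x2] becomes linear
    with leading coefficient [x3]; so only the leading coefficient of [q] and powers of [x3]
    appear. *)
Lemma lead_psi_orbit f : exists L, orbit_const (x3 k ^+ L * lead_coef (psi f)).
Proof.
have [L [q [oq eq]]] := orbit_poly_repr f; exists L.
have := congr1 (@psi k) eq; rewrite rmorphM -horner_map /=.
have -> : map_poly (@psi k) q = map_poly polyC q.
  by apply/polyP => i; rewrite !coef_map /=; case: (oq i).
rewrite rmorphXn /= psi3 -[(map_poly _ _).[_]]/(q \Po psi (x2 k)) -rmorphXn /=.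
have [s2 [c c0 l2]] := lead_psi2 k => /(congr1 lead_coef).
rewrite lead_coefM lead_coefC lead_coef_comp ?s2 // => ->.
apply: orbit_constM; first exact: oq.
apply: orbit_constX; rewrite l2; apply: orbit_constM; first exact: orbit_constC.
exact/orbit_constX/orbit_const_x3.
Qed.

Lemma size_iter_shift_diff (q : {poly kV k}) e j : (j <= e %% p)%N ->
  size q = e.+1 -> size (iter j (shift_diff 1) q) = (e - j).+1.
Proof.
move=> + sq; elim: j => [|j IHj] le_j; first by rewrite subn0.
rewrite /= subnS; have := IHj (ltnW le_j); set r := iter _ _ _ => sr.
have le_e := leq_mod e p.
have ne : (e - j)%N%:R != 0 :> kV k.
  rewrite -(rmorph_nat (@mpolyC 3 k)) /= mpolyC_eq0 -(dvdn_pcharf char_k).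
  rewrite {1}(divn_eq e p) -addnBA 1?ltnW // dvdn_addr ?dvdn_mull //.
  apply/negP => /dvdn_leq; rewrite subn_gt0 => /(_ le_j).
  by rewrite leqNgt (leq_ltn_trans (leq_subr _ _)) // ltn_pmod // prime_gt0.
have [-> _] := shift_diff_lead (oner_neq0 _) sr ne.
by rewrite prednK // subn_gt0 (leq_trans le_j).
Qed.

(** With a residue of at least n, n differences would lower the degree by exactly n and leave a
    nonzero polynomial. *)
Lemma size_psi_mod f e : iter n (@Delta k) f = 0 -> size (psi f) = e.+1 -> (e %% p < n)%N.
Proof.
move=> Df sf; rewrite ltnNge; apply/negP => /size_iter_shift_diff/(_ sf).
by rewrite -psi_iter_Delta Df rmorph0 size_poly0.
Qed.

Lemma gen_span_upto f : iter n (@Delta k) f = 0 ->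
  exists L, gen_span (x3 k ^+ L * f).
Proof.
move: (leqnn (size (psi f))); move: {2}(size _) => N.
elim: N f => [|N IHN] f.
  rewrite leqn0 size_poly_eq0 => /eqP f0 _; exists 0%N.
  by rewrite -(psi_at0 f) f0 horner0 mulr0; apply: gen_span0.
rewrite leq_eqVlt => /predU1P[sf Df|lt_f Df]; last exact: IHN.
(* Some [a3 ^ a * gen i] has the same degree in t as [f]. *)
have [i [a [lt_i eN]]] := gen_tdeg_surj p_odd n_ge1 n_le_p (size_psi_mod Df sf).
have [L [[P eP] oP]] := lead_psi_orbit f.
have oP' : psi (evalA P) = (evalA P)%:P by rewrite -eP.
have [m1 l1] := lead_psi_gen p_prime p_odd char_k n_ge1 n_le_p lt_i.
have [m2 l2] := lead_psi_a3 p_prime p_odd char_k.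
have [] := lead_formM (lead_formX a l2) l1; rewrite addnC -eN.
set m := (a * m2 + m1)%N => sg [c c0 lg].
set g := a3 k p ^+ a * gen k p n i.
have eg : psi g = psi (a3 k p) ^+ a * psi (gen k p n i) by rewrite rmorphM rmorphXn.
rewrite -eg in sg lg.
have Dg : gen_span g.
  by rewrite /g -evalA3 -rmorphXn; apply: gen_spanM; apply: gen_span_gen.
(* Leading terms cancel in [f']: [evalA P] is [x3 ^ L] times the leading coefficient of [psi f], and
   [c * x3 ^ m] is that of [psi g]. *)
clearbody g; pose f' := c%:MP * x3 k ^+ (L + m) * f - evalA P * g.
have s3 := sigma_evalA (c%:MP * x1 k ^+ (L + m)).
rewrite rmorphM rmorphXn /= evalAC evalA1 in s3.
have Df' : iter n (@Delta k) f' = 0.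
  rewrite Delta_iterB (Delta_iterM _ _ s3) Df mulr0.
  by rewrite Delta_iter_gen_span ?subrr //; apply: gen_spanM.
have sf' : (size (psi f') <= N)%N.
  have -> : psi f' = (c%:MP * x3 k ^+ (L + m)) *: psi f - evalA P *: psi g.
    rewrite rmorphB !rmorphM /= rmorphXn /= psi3 psiC oP' -!mul_polyC.
    by rewrite [(c%:MP * _)%:P]polyCM [(_ ^+ (L + m))%:P]rmorphXn.
  exact: size_lead_cancel sf sg eP lg.
have [L' sp] := IHN _ sf' Df'; exists (L' + (L + m))%N.
have -> : x3 k ^+ (L' + (L + m)) * f = 
   evalA c^-1%:MP * (x3 k ^+ L' * f' + evalA (x1 k ^+ L' * P) * g).
  have cV : c^-1%:MP * c%:MP = 1 :> kV k by rewrite -mpolyCM mulVf.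
  rewrite evalAC (rmorphM _ (x1 k ^+ L')) rmorphXn /= evalA1 /f'.
  rewrite exprD -[LHS]mul1r -cV; ring.
by apply: gen_spanM; apply: gen_spanD => //; apply: gen_spanM.
Qed.

End Span.

(** * Independence modulo [x3] *)

Section KeyedSums.

Variables (S : nzRingType) (p : nat).

(* Nonzero [u]s with distinct keys [(d mod p, e)] have no common leading
   monomial, so they cannot cancel. *)
Definition keyed (u : {poly {poly S}}) (d : nat) (e : bool) :=
  u != 0 -> (size u).-1 = d %[mod p] /\
            forall l, (lead_coef u)`_l != 0 -> odd l = e.

Lemma keyed_sum_eq0 (I : finType) (u : I -> {poly {poly S}})
    (d : I -> nat) (e : I -> bool) :
    (forall i, keyed (u i) (d i) (e i)) ->
    (forall i j, d i = d j %[mod p] -> e i = e j -> i = j) ->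
  \sum_i u i = 0 -> forall i, u i = 0.
Proof.
move=> key_u key_inj u0 i0; apply: contraTeq isT => ui0.
have [i _ max_i] := @arg_maxnP I i0 xpredT (fun i => size (u i)) isT.
have ui : u i != 0.
  by rewrite -size_poly_gt0 (leq_trans _ (max_i i0 isT)) // size_poly_gt0.
have [di ei] := key_u i ui.
set l := (size (lead_coef (u i))).-1.
have li : (lead_coef (u i))`_l != 0 by rewrite -lead_coefE !lead_coef_eq0.
have := congr1 (fun q : {poly {poly S}} => q`_(size (u i)).-1`_l) u0.
rewrite !coef0 coef_sum coef_sum (bigD1 i) //= big1 ?addr0 => [/eqP|j ne_ji].
  by rewrite -lead_coefE (negPf li).
apply/eqP; apply: contraNT ne_ji => lj.
have uj : u j != 0 by apply: contraNneq lj => ->; rewrite !coef0.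
(* Maximality bounds the degree of [u j] above, its nonzero coefficient bounds it below. *)
have sj : (size (u j)).-1 = (size (u i)).-1.
  have gt_j : ((size (u i)).-1 < size (u j))%N.
    by rewrite ltnNge; apply: contra lj => /leq_sizeP ->; rewrite ?coef0.
  by have := max_i j isT; lia.
have [dj ej] := key_u j uj.
apply/eqP/key_inj; first by rewrite -dj sj di.
by rewrite -(ei l li) (ej l) // lead_coefE sj.
Qed.

End KeyedSums.

Section Reduction.

Variables (k : fieldType) (p n : nat).

(* Reduction modulo [x3]: [x1] becomes the outer variable, [x2] the inner one. *)
Definition mod_x3 : kV k -> {poly {poly k}} :=
  ev3 (polyC \o @polyC k) [tuple 'X; 'X%:P; 0].
HB.instance Definition _ := GRing.RMorphism.on mod_x3.

Lemma mod_x3C c : mod_x3 c%:MP = c%:P%:P. Proof. exact: ev3C. Qed.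
Lemma mod_x3_1 : mod_x3 (x1 k) = 'X. Proof. exact: ev3X. Qed.
Lemma mod_x3_2 : mod_x3 (x2 k) = 'X%:P. Proof. exact: ev3X. Qed.
Lemma mod_x3_3 : mod_x3 (x3 k) = 0. Proof. exact: ev3X. Qed.
#[global] Opaque mod_x3.

(* Reduction modulo the first variable of the coefficient ring of [evalA]. *)
Definition mod_y1 : kV k -> {poly {poly k}} :=
  ev3 (polyC \o @polyC k) [tuple 0; 'X%:P; 'X].
HB.instance Definition _ := GRing.RMorphism.on mod_y1.

Lemma mod_y1C c : mod_y1 c%:MP = c%:P%:P. Proof. exact: ev3C. Qed.
Lemma mod_y1_1 : mod_y1 (x1 k) = 0. Proof. exact: ev3X. Qed.
Lemma mod_y1_2 : mod_y1 (x2 k) = 'X%:P. Proof. exact: ev3X. Qed.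
Lemma mod_y1_3 : mod_y1 (x3 k) = 'X. Proof. exact: ev3X. Qed.
#[global] Opaque mod_y1.

Lemma mod_x3_sigma f : mod_x3 (sigma f) = mod_x3 f \Po ('X + ('X ^+ 1)%:P).
Proof.
apply: (@kV_ext k _ (mod_x3 \o @sigma k) (comp_poly ('X + ('X ^+ 1)%:P) \o mod_x3)) => /=.
- by move=> c; rewrite sigmaC mod_x3C comp_polyC.
- by rewrite sigmaX1 rmorphD /= mod_x3_1 mod_x3_2 comp_polyX.
- by rewrite sigmaX2 rmorphD /= mod_x3_2 mod_x3_3 comp_polyC addr0.
- by rewrite sigmaX3 mod_x3_3 comp_poly0.
Qed.

Lemma comp_mpolyX3 (P : kV k) : P \mPo [tuple x1 k; x2 k; x3 k] = P.
Proof.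
apply: (@kV_ext k _ (comp_mpoly [tuple x1 k; x2 k; x3 k]) idfun) => [c|||] /=.
- exact: comp_mpolyC.
- exact: comp_mpolyXU.
- exact: comp_mpolyXU.
- exact: comp_mpolyXU.
Qed.

(** [P] is congruent modulo [x1] to its value at [x1 = 0], which [mod_y1 P] determines. *)
Lemma mod_y1_eq0 P : mod_y1 P = 0 -> exists Q, P = x1 k * Q.
Proof.
move=> P0.
(* [theta] sends the outer variable to [x3] and the inner one to [x2], so [theta \o mod_y1] sets
   [x1] to 0. *)
pose theta : {rmorphism {poly {poly k}} -> kV k} := horner_eval (x3 k) \o map_poly
  (horner_eval (x2 k) \o map_poly (@mpolyC 3 k)).
have e : P \mPo [tuple 0; x2 k; x3 k] = 0.
  rewrite -[RHS](rmorph0 theta) -[in RHS]P0.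
  apply: (@kV_ext k _ (comp_mpoly [tuple 0; x2 k; x3 k]) (theta \o mod_y1)) => [c|||] /=.
  - by rewrite comp_mpolyC mod_y1C map_polyC /= /horner_eval hornerC map_polyC hornerC.
  - by rewrite comp_mpolyXU mod_y1_1 !rmorph0.
  - by rewrite comp_mpolyXU mod_y1_2 map_polyC /= /horner_eval hornerC map_polyX hornerX.
  - by rewrite comp_mpolyXU mod_y1_3 map_polyX /= /horner_eval hornerX.
have := @comp_mpoly_congr 3 3 k (fun f => exists Q, f = x1 k * Q)
  [tuple x1 k; x2 k; x3 k] [tuple 0; x2 k; x3 k] P.
rewrite e subr0 comp_mpolyX3; apply.
  split; first by exists 0; rewrite mulr0.
    by move=> f g [Q ->] [Q' ->]; exists (Q + Q'); rewrite mulrDr.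
  by move=> a f [Q ->]; exists (a * Q); rewrite mulrCA.
move=> i; rewrite !(tnth_nth 0); case: i => [[|[|[|//]]] ?] /=.
- by exists 1; rewrite subr0 mulr1.
- by exists 0; rewrite subrr mulr0.
- by exists 0; rewrite subrr mulr0.
Qed.

(** With the next lemma this gives regularity of the variables, which passes to [a1, a2, a3] through
    the coefficients of covariants. *)
Lemma x2_colon P R : x2 k * P = x1 k * R -> exists Q, P = x1 k * Q.
Proof.
move=> e; apply: mod_y1_eq0; have := congr1 mod_y1 e.
rewrite !rmorphM /= mod_y1_1 mod_y1_2 mul0r => /eqP; rewrite mulf_eq0.
by rewrite polyC_eq0 polyX_eq0 => /eqP.
Qed.

Lemma x3_colon P Q R : x3 k * P - x2 k * Q = x1 k * R ->
  exists Q1 Q2, P = x1 k * Q1 + x2 k * Q2.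
Proof.
move=> e.
have e0 : P \mPo [tuple 0; 0; x3 k] = 0.
  have := congr1 (comp_mpoly [tuple 0; 0; x3 k]) e.
  rewrite rmorphB !rmorphM /=.
  have c1 : x1 k \mPo [tuple 0; 0; x3 k] = 0 by exact: comp_mpolyXU.
  have c2 : x2 k \mPo [tuple 0; 0; x3 k] = 0 by exact: comp_mpolyXU.
  have c3 : x3 k \mPo [tuple 0; 0; x3 k] = x3 k by exact: comp_mpolyXU.
  rewrite c1 c2 c3 !mul0r subr0 => /eqP; rewrite mulf_eq0 (negPf (x_neq0 _ _)).
  by move/eqP.
have := @comp_mpoly_congr 3 3 k (fun f => exists Q1 Q2, f = x1 k * Q1 + x2 k * Q2)
  [tuple x1 k; x2 k; x3 k] [tuple 0; 0; x3 k] P.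
rewrite e0 subr0 comp_mpolyX3; apply.
  split; first by exists 0, 0; rewrite !mulr0 addr0.
    move=> f g [Q1 [Q2 ->]] [Q1' [Q2' ->]]; exists (Q1 + Q1'), (Q2 + Q2').
    by rewrite !mulrDr addrACA.
  by move=> a f [Q1 [Q2 ->]]; exists (a * Q1), (a * Q2); rewrite mulrDr ![a * _]mulrCA.
move=> i; rewrite !(tnth_nth 0); case: i => [[|[|[|//]]] ?] /=.
- by exists 1, 0; rewrite subr0 mulr1 mulr0 addr0.
- by exists 0, 1; rewrite subr0 mulr1 mulr0 add0r.
- by exists 0, 0; rewrite subrr !mulr0 addr0.
Qed.

Hypotheses (p_prime : prime p) (p_odd : odd p) (char_k : p \in [pchar k]).
Hypotheses (n_ge1 : (1 <= n)%N) (n_le_p : (n <= p)%N).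

Lemma lead_mod_x3_1 : lead_form (@polyC k) 'X (mod_x3 (x1 k)) 1 0.
Proof.
rewrite mod_x3_1; split; first by rewrite size_polyX.
by exists 1; rewrite ?oner_eq0 // lead_coefX mul1r.
Qed.

Lemma lead_mod_x3_2 : lead_form (@polyC k) 'X (mod_x3 (x2 k)) 0 1.
Proof.
rewrite mod_x3_2; split; first by rewrite size_polyC polyX_eq0.
by exists 1; rewrite ?oner_eq0 // lead_coefC mul1r.
Qed.

Lemma lead_mod_x3_gen i : (i < n + n)%N -> exists2 m,
  lead_form (@polyC k) 'X (mod_x3 (gen k p n i)) (gen_xdeg n i) m & odd m = odd i.
Proof.
case/(gen_xdegP p_odd n_ge1 n_le_p) => le_c <- odd_m; rewrite genE; eexists; last exact: odd_m.
apply: (rho_monomial (r := 1) char_k (negbT (polyX_eq0 _)) _ lead_mod_x3_1 lead_mod_x3_2 le_c).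
exact: mod_x3_sigma.
Qed.

Lemma size_mod_x3_a3 : size (mod_x3 (a3 k p)) = p.+1 /\ mod_x3 (a3 k p) \is monic.
Proof.
have -> : mod_x3 (a3 k p) = \prod_(i < p) ('X - (- (i%:R * 'X))%:P).
  rewrite /a3 rmorph_prod /=; apply: eq_bigr => i _; rewrite polyCN opprK.
  elim: (i : nat) => [|j IHj]; first by rewrite mul0r addr0 mod_x3_1.
  rewrite iterS mod_x3_sigma IHj comp_polyD comp_polyX comp_polyC.
  by rewrite -addrA -polyCD -[j.+1%:R]natr1 mulrDl mul1r [_ * 'X + 'X]addrC.
rewrite -(big_mkord xpredT (fun i => 'X - (- (i%:R * 'X))%:P)).
by rewrite monic_prod_XsubC size_prod_XsubC size_iota subn0.
Qed.

(** Modulo [x3], [a1] vanishes and [a2] becomes [x2^2], hence the inner substitution of ['X^2]; the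
    outer variable stands for [a3]. *)
Lemma mod_x3_evalA P :
  mod_x3 (evalA p P) = map_poly (comp_poly 'X^2) (mod_y1 P) \Po mod_x3 (a3 k p).
Proof.
apply: (@kV_ext k _ (mod_x3 \o @evalA k p)
   (comp_poly (mod_x3 (a3 k p)) \o map_poly (comp_poly 'X^2) \o mod_y1)) => [c|||] /=.
- by rewrite evalAC mod_x3C mod_y1C map_polyC /= comp_polyC comp_polyC.
- by rewrite evalA1 mod_x3_3 mod_y1_1 rmorph0 comp_poly0.
- rewrite evalA2 mod_y1_2 map_polyC /= comp_polyX comp_polyC.
  rewrite /a2 !(rmorphB, rmorphM, rmorphXn) /= mod_x3_2 mod_x3_3 !mulr0 !subr0.
  by [].
- by rewrite evalA3 mod_y1_3 map_polyX comp_polyX.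
Qed.

(** Neither substitution kills a nonzero polynomial. The degree is divisible by p and the leading
    coefficient even in [x2], so coefficients from [A] preserve keys. *)
Lemma mod_x3_evalA_lead P (Q := mod_y1 P) :
  [/\ size (mod_x3 (evalA p P)) = if Q == 0 then 0%N else ((size Q).-1 * p).+1 &
     lead_coef (mod_x3 (evalA p P)) = lead_coef Q \Po 'X^2].
Proof.
have [sa ma] := size_mod_x3_a3.
have inj2 : injective (comp_poly ('X^2 : {poly k})).
  move=> u v /eqP; rewrite -subr_eq0 -rmorphB comp_poly_eq0 ?size_polyXn //.
  by rewrite subr_eq0 => /eqP.
have inj0 (u : {poly k}) : (u \Po 'X^2 == 0) = (u == 0).
  by rewrite comp_poly_eq0 ?size_polyXn.
have sQ : size (map_poly (comp_poly ('X^2 : {poly k})) Q) = size Q.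
  by apply: size_map_inj_poly => //; rewrite rmorph0.
have lQ : lead_coef (map_poly (comp_poly ('X^2 : {poly k})) Q) = lead_coef Q \Po 'X^2.
  by apply: lead_coef_map_inj => //; rewrite rmorph0.
rewrite mod_x3_evalA -/Q; split; last first.
  rewrite lead_coef_comp ?sa ?ltnS ?prime_gt0 // lQ (monicP ma) expr1n mulr1 //.
case: eqP => [->|/eqP Q0]; first by rewrite rmorph0 comp_poly0 size_poly0.
rewrite -[LHS]prednK; first by rewrite size_comp_poly sa sQ.
rewrite size_poly_gt0 comp_poly_eq0 ?sa ?ltnS ?prime_gt0 //.
by rewrite -size_poly_eq0 sQ size_poly_eq0.
Qed.

Lemma keyed_gen_term P i : (i < n + n)%N ->
  keyed p (mod_x3 (evalA p P * gen k p n i)) (gen_xdeg n i) (odd i).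
Proof.
case/lead_mod_x3_gen => m [sg [c c0 lg]] <-; rewrite rmorphM /= => nz.
have [sP lP] := mod_x3_evalA_lead P.
have Q0 : mod_y1 P != 0.
  apply: contraNneq nz => Q0; rewrite Q0 eqxx in sP.
  by move/eqP: sP; rewrite size_poly_eq0 => /eqP ->; rewrite mul0r.
rewrite (negPf Q0) in sP.
split.
  rewrite size_mul -?size_poly_eq0 ?sP ?sg //.
  by rewrite addSn addnS /= modnMDl.
move=> l; rewrite lead_coefM lP lg mulrA coefMXn; case: ltnP => [|le_ml]; first by rewrite eqxx.
rewrite coefMC coef_comp_poly_Xn //; case: ifP => [d2 _|]; last by rewrite mul0r eqxx.
by rewrite -(subnK le_ml) oddD -[odd (l - m)]negbK -dvdn2 d2.
Qed.

(** Modulo [x3] the right side vanishes, distinct keys make every summand vanish, and no generator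
    is 0 there; so each coefficient is 0 modulo its first variable. *)
Lemma gen_relation_mod_x3 (c : 'I_(n + n) -> kV k) g :
    \sum_(i < n + n) evalA p (c i) * gen k p n i = x3 k * g ->
  forall i, exists Q, c i = x1 k * Q.
Proof.
move=> e i; apply: mod_y1_eq0.
have := congr1 mod_x3 e; rewrite rmorphM /= mod_x3_3 mul0r rmorph_sum /=.
have key j : keyed p (mod_x3 (evalA p (c j) * gen k p n j)) (gen_xdeg n j) (odd j).
  by apply: keyed_gen_term.
have key_inj (j1 j2 : 'I_(n + n)) : gen_xdeg n j1 = gen_xdeg n j2 %[mod p] ->
    odd j1 = odd j2 -> j1 = j2.
  by move=> d o; apply/val_inj/(gen_key_inj p_odd n_ge1 n_le_p _ _ d).
move/(keyed_sum_eq0 key key_inj)/(_ i).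
rewrite rmorphM /= => /eqP; rewrite mulf_eq0 => /orP[|g0].
  rewrite -size_poly_eq0; have [-> _] := mod_x3_evalA_lead (c i).
  by case: ifP => [/eqP|].
have [m /lead_form_neq0] := lead_mod_x3_gen (ltn_ord i).
by rewrite g0.
Qed.

(** Factors [x3] are removed one at a time, since they divide all coefficients by the preceding
    lemma. *)
Lemma gen_span_ker f : iter n (@Delta k) f = 0 -> gen_span p n f.
Proof.
move=> /(gen_span_upto p_prime p_odd char_k n_ge1 n_le_p)[L].
elim: L => [|L IHL]; first by rewrite mul1r.
rewrite exprS -mulrA => -[c e]; apply: IHL.
have [Q eQ] : exists Q : 'I_(n + n) -> kV k, forall i, c i = x1 k * Q i.
  exact: (fin_all_exists (gen_relation_mod_x3 (esym e))).
exists Q; apply: (mulfI (x_neq0 k (@Ordinal 3 2 isT))); rewrite -/(x3 k) e mulr_sumr.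
by apply: eq_bigr => i _; rewrite eQ rmorphM /= evalA1 mulrA.
Qed.

End Reduction.

Lemma spannedE (R : nzRingType) (M : lmodType R) (A : R -> Prop) (s : seq M)
    (N : nat) (F : 'I_N -> M) (m : M) :
    size s = N -> (forall i : 'I_N, s`_i = F i) ->
  spanned A s m <->
  exists c : 'I_N -> R, (forall i, A (c i)) /\ m = \sum_(i < N) c i *: F i.
Proof.
move=> sN; subst N => eF; split=> -[c [Ac ->]]; exists c; split=> //;
  by apply: eq_bigr => i _; rewrite eF.
Qed.

(** * Covariants and [Theta] *)

Section Covariants.

Variables (k : fieldType) (n : nat).
Implicit Types (phi : kVW k n) (f : kV k).

(** The inverse of [sigma_W]. With it, invariance reads [sigma phi_j = phi_j + phi_(j+1)]. *)
Definition shift_W : 'M[kV k]_n :=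
  \matrix_(i < n, j < n) ((i == j)%:R + (i == j.+1 :> nat)%:R).

Lemma mul_shift_W phi (j : 'I_n) :
  (phi *m shift_W) 0 j = phi 0 j + (if insub j.+1 is Some j' then phi 0 j' else 0).
Proof.
rewrite mxE; under eq_bigr do rewrite mxE mulrDr.
rewrite big_split /= (bigD1 j) //= eqxx mulr1 big1 ?addr0 => [|i /negPf ->]; last by rewrite mulr0.
congr (_ + _); case: insubP => [j' _ ej'|]; last first.
  move=> le_n; rewrite big1 // => i _; case: eqP => [e|_]; last by rewrite mulr0.
  by rewrite -e ltn_ord in le_n.
rewrite (bigD1 j') //= ej' eqxx mulr1 big1 ?addr0 // => i ne_i.
by rewrite -ej' (inj_eq val_inj) (negPf ne_i) mulr0.
Qed.

Lemma sigma_W_shift : sigma_W k n *m shift_W = 1%:M.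
Proof.
apply/row_matrixP => i; rewrite row_mul; apply/rowP => j.
rewrite mul_shift_W !mxE; case: insubP => [j' _ ej'|] /=; last first.
  have lt_i := ltn_ord i; rewrite -leqNgt => le_n; rewrite addr0.
  case: leqP => le_ji; last by case: eqP le_ji => [->|//]; rewrite ltnn.
  have -> : i = j.
    by apply/val_inj/eqP; rewrite /= eqn_leq le_ji andbT -ltnS (leq_trans lt_i).
  by rewrite subnn eqxx expr0.
rewrite !mxE ej'; case: (ltngtP j i) => [lt_ji|lt_ij|/val_inj ->].
- have -> : (i == j) = false by apply/eqP => e; rewrite e ltnn in lt_ji.
  rewrite (_ : (i - j)%N = (i - j.+1).+1); last by lia.
  by rewrite exprS mulN1r addNr.
- have -> : (i == j) = false by apply/eqP => e; rewrite e ltnn in lt_ij.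
  by rewrite addr0.
- by rewrite eqxx subnn expr0 addr0.
Qed.

Lemma sigma_VW_fixed phi :
  sigma_VW phi = phi <-> map_mx (@sigma k) phi = phi *m shift_W.
Proof.
rewrite /sigma_VW; split=> [{2}<-|->]; first by rewrite -mulmxA sigma_W_shift mulmx1.
by rewrite -mulmxA (mulmx1C sigma_W_shift) mulmx1.
Qed.

(** Invariance says that [Delta] moves each coordinate to the next and kills the last, so the first
    coordinate is the required [f]. *)
Lemma sigma_VW_fixedP phi : (1 <= n)%N ->
  sigma_VW phi = phi <-> exists2 f, iter n (@Delta k) f = 0 & phi = Theta n f.
Proof.
move=> n_ge1; rewrite sigma_VW_fixed; split=> [fix_phi|[f Df ->]]; last first.
  apply/rowP => j; rewrite mul_shift_W !mxE.
  have -> : sigma (iter j (@Delta k) f) = iter j (@Delta k) f + iter j.+1 (@Delta k) f.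
    by rewrite /= {2}/Delta addrC subrK.
  congr (_ + _); case: insubP => [j' _ <-|]; first by rewrite mxE.
  rewrite -leqNgt => le_nj; have -> // : j.+1 = n.
  by apply/eqP; rewrite eqn_leq le_nj ltn_ord.
have D j : Delta (phi 0 j) = if insub j.+1 is Some j' then phi 0 j' else 0.
  have := congr1 (fun u : kVW k n => u 0 j) fix_phi; rewrite mul_shift_W mxE /Delta => ->.
  by rewrite addrC addKr.
pose i0 := Ordinal n_ge1.
have it j (lt_j : (j < n)%N) : iter j (@Delta k) (phi 0 i0) = phi 0 (Ordinal lt_j).
  elim: j lt_j => [|j IHj] lt_j; first by congr (phi 0 _); apply: val_inj.
  by rewrite iterS (IHj (ltnW lt_j)) D insubT.
exists (phi 0 i0); last by apply/rowP => j; rewrite mxE it; congr (phi 0 _); apply: val_inj.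
have lt_n : (n.-1 < n)%N by rewrite prednK.
have -> x : iter n (@Delta k) x = Delta (iter n.-1 (@Delta k) x) by rewrite -iterS prednK.
by rewrite (it _ lt_n) D insubF //= prednK // ltnn.
Qed.

Variable p : nat.
Hypotheses (p_prime : prime p).

Lemma iter_fixed (T : eqType) (F : T -> T) x :
  reflect (F x = x) [forall i : 'I_p, iter i F x == x].
Proof.
apply: (iffP forallP) => [/(_ (Ordinal (prime_gt1 p_prime)))/eqP //|Fx i].
by apply/eqP; elim: (i : nat) => //= j ->.
Qed.

Lemma invariants_fixed f : reflect (sigma f = f) (f \in invariants k p).
Proof. exact: iter_fixed. Qed.

Lemma covariants_fixed phi : reflect (sigma_VW phi = phi) (phi \in covariants k p n).
Proof. exact: iter_fixed. Qed.

Lemma ThetaM a f : sigma a = a -> Theta n (a * f) = a *: Theta n f.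
Proof. by move=> sa; apply/rowP => j; rewrite !mxE Delta_iterM. Qed.

Lemma Theta_sum (I : finType) (F : I -> kV k) :
  Theta n (\sum_i F i) = \sum_i Theta n (F i).
Proof.
apply/rowP => j; rewrite mxE Delta_iter_sum summxE.
by apply: eq_bigr => i _; rewrite mxE.
Qed.

Hypotheses (p_odd : odd p) (char_k : p \in [pchar k]).
Hypotheses (n_ge1 : (1 <= n)%N) (n_le_p : (n <= p)%N).

Lemma covariants_span phi : phi \in covariants k p n <->
  exists c : 'I_(n + n) -> kV k,
    phi = \sum_(i < n + n) evalA p (c i) *: Theta n (gen k p n i).
Proof.
split=> [/covariants_fixed/(sigma_VW_fixedP _ n_ge1)[f Df ->]|[c ->]].
  have [c ->] := gen_span_ker p_prime p_odd char_k n_ge1 n_le_p Df; exists c.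
  by rewrite Theta_sum; apply: eq_bigr => i _; rewrite ThetaM // sigma_evalA.
apply/covariants_fixed/(sigma_VW_fixedP _ n_ge1).
exists (\sum_(i < n + n) evalA p (c i) * gen k p n i).
  apply: (Delta_iter_gen_span p_prime p_odd char_k n_ge1 n_le_p).
  by exists c.
by rewrite Theta_sum; apply: eq_bigr => i _; rewrite ThetaM // sigma_evalA.
Qed.

Lemma covariants_spanned phi :
  phi \in covariants k p n <-> spanned (algA k p) (generators k p n) phi.
Proof.
have e := @spannedE _ _ (algA k p) (generators k p n) (n + n)
   (fun i => Theta n (gen k p n i)) phi.
rewrite e; first last.
- move=> i; rewrite /generators nth_cat size_map size_iota /gen.
  case: ltnP => [lt_in|le_ni]; first by rewrite (nth_map 0%N) ?size_iota // nth_iota.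
  have lt_i : (i - n < n)%N by rewrite ltn_subLR.
  by rewrite (nth_map 0%N) ?size_iota // nth_iota.
- by rewrite size_cat !size_map !size_iota.
rewrite covariants_span; split=> [[c ->]|[c [/fin_all_exists[P eP] ->]]].
  by exists (fun i => evalA p (c i)); split=> // i; exists (c i).
by exists P; apply: eq_bigr => i _; rewrite eP.
Qed.

End Covariants.

(** * Algebraic dependence, chains of primes and regular sequences *)

Section Collapse.

Variable R : comNzRingType.
Implicit Types (s t : seq R) (a x : R).

(* If [collapse (x :: s) 0] then [x ^ e * (b + x * h) = 0] for some [b] that
   collapses modulo [x] in the same way, down to a unit: this is an algebraic
   relation with its lexicographically smallest monomial singled out. *)
Fixpoint collapse s a : Prop :=
  if s is x :: s' then exists e h b, collapse s' b /\ a = x ^+ e * (b + x * h)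
  else exists u, u * a = 1.

Fixpoint mon_idx (N : nat) s : finType :=
  if s is _ :: s' then ('I_N * mon_idx N s')%type : finType else unit.

Fixpoint mon N s : mon_idx N s -> R :=
  match s return mon_idx N s -> R with
  | [::] => fun=> 1
  | x :: s' => fun m => x ^+ m.1 * mon m.2
  end.

Lemma card_mon_idx N s : #|mon_idx N s| = (N ^ size s)%N.
Proof.
elim: s => [|x s IHs] /=; first by rewrite card_unit.
by rewrite card_prod card_ord IHs expnS.
Qed.

Lemma collapse_sum N s (c : mon_idx N s -> R) :
    (forall m, c m = 0 \/ exists u, u * c m = 1) -> (exists m, c m != 0) ->
  collapse s (\sum_m c m * mon m).
Proof.
elim: s c => [|x s IHs] /= c c_unit [m0 cm0].
  rewrite (bigD1 tt) //= big1 => [|[] //]; rewrite addr0 mulr1.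
  by case: m0 cm0 => nz; case: (c_unit tt) => // c0; rewrite c0 eqxx in nz.
pose B d := \sum_(m : mon_idx N s) c (d, m) * mon m.
have -> : \sum_(m : 'I_N * mon_idx N s) c m * (x ^+ m.1 * mon m.2) =
      \sum_(d < N) x ^+ d * B d.
  transitivity (\sum_(d < N) \sum_m c (d, m) * (x ^+ d * mon m)).
    by rewrite pair_bigA; apply: eq_bigr => -[].
  by apply: eq_bigr => d _; rewrite mulr_sumr; apply: eq_bigr => m _; rewrite mulrCA.
have ex_d : [exists m, c (m0.1, m) != 0] by apply/existsP; exists m0.2; case: (m0) cm0.
have [e /existsP[m cem] min_e] := @arg_minnP _ m0.1 (fun d : 'I_N => [exists m, c (d, m) != 0])
   (@nat_of_ord N) ex_d.
(* [e] is the least exponent of [x] with a nonzero coefficient; [h] gathers the higher powers,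
   lowered by [e + 1]. *)
exists e, (\sum_(d < N | d != e) if (e < d)%N then x ^+ (d - e.+1) * B d else 0), (B e).
split; first by apply: IHs => [m'|]; [apply: c_unit | exists m].
rewrite (bigD1 e) //= mulrDr; congr (_ + _); rewrite !mulr_sumr.
apply: eq_bigr => d ne_de; case: (ltngtP e d) => [lt_ed|lt_de|/val_inj ed].
- by rewrite !mulrA -exprSr -exprD subnKC.
- rewrite /B big1 ?mulr0 // => m' _; apply/eqP; apply: contraTT lt_de => nz.
  rewrite -leqNgt; apply: min_e; apply/existsP; exists m'.
  by apply: contraNneq nz => ->; rewrite mul0r.
- by rewrite ed eqxx in ne_de.
Qed.

(** As [x] lies outside the prime [P i], the factor [x ^ e] drops out; as [x] lies in [P i.+1], so
    does [b]. At the end a prime would contain a unit. *)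
Lemma collapse_prime_chain (P : nat -> R -> Prop) s i a :
    (forall j, (j <= size s)%N -> prime_ideal (P (i + j)%N)) ->
    (forall j, (j < size s)%N -> [/\ forall b, P (i + j)%N b -> P (i + j).+1 b,
       P (i + j).+1 s`_j & ~ P (i + j)%N s`_j]) ->
  collapse s a -> ~ P i a.
Proof.
elim: s i a => [|x s IHs] i a prP chP.
  case=> u u1 Pa; have := prP 0%N isT; rewrite addn0 => -[[_ _ PM] P1 _].
  by apply: P1; rewrite -u1; apply: PM.
case=> e [h [b [col_b ->]]] Pa.
have := chP 0%N isT; rewrite addn0 => -[incl Px nPx].
have := prP 0%N isT; rewrite addn0 => -[_ _ PMv].
have := prP 1%N isT; rewrite addn1 => -[[_ PD PM] _ _].
have Pi : P i (b + x * h).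
  elim: e Pa => [|e IHe]; first by rewrite mul1r.
  by rewrite exprS -mulrA => /PMv[].
apply: (IHs i.+1 b) => //.
- by move=> j le_j; rewrite addSnnS; apply: prP.
- by move=> j lt_j; have := chP j.+1 lt_j; rewrite addnS addSn.
have -> : b = (b + x * h) + - h * x by ring.
by apply: PD; [apply: incl | apply: PM].
Qed.

Section RegularSequences.

Variable M : lmodType R.

Lemma ideal_mulP s (m : M) :
  ideal_mul s m <-> exists c : nat -> M, m = \sum_(i < size s) s`_i *: c i.
Proof.
split=> [[c ->]|[c ->]]; last by exists (fun i : 'I__ => c i).
exists (fun i => if insub i is Some j then c j else 0).
by apply: eq_bigr => i _; rewrite valK.
Qed.

Lemma ideal_mul0 (m : M) : ideal_mul [::] m <-> m = 0.
Proof.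
rewrite ideal_mulP; split=> [[c ->]|->]; first by rewrite big_ord0.
by exists (fun=> 0); rewrite big_ord0.
Qed.

Lemma ideal_mul_rcons s x (m : M) :
  ideal_mul (rcons s x) m <-> exists m1 m2, ideal_mul s m1 /\ m = m1 + x *: m2.
Proof.
rewrite ideal_mulP size_rcons; split=> [[c ->]|[m1 [m2 [/ideal_mulP[c ->] ->]]]].
  rewrite big_ord_recr nth_rcons ltnn eqxx /=.
  exists (\sum_(i < size s) s`_i *: c i), (c (size s)); split.
    by apply/ideal_mulP; exists c.
  by congr (_ + _); apply: eq_bigr => i _; rewrite nth_rcons ltn_ord.
exists (fun i => if i == size s then m2 else c i).
rewrite big_ord_recr nth_rcons ltnn eqxx /=; congr (_ + _).
by apply: eq_bigr => i _; rewrite nth_rcons ltn_ord ltn_eqF.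
Qed.

(** [t] holds the elements already used. Regularity of [x] modulo [t] removes [x ^ e], and [b] acts
    as 0 modulo [rcons t x]; finally a unit does so, against properness. *)
Lemma collapse_regular t s a :
    (forall i, (size t <= i < size (t ++ s))%N -> forall m : M,
       ideal_mul (take i (t ++ s)) ((t ++ s)`_i *: m) ->
       ideal_mul (take i (t ++ s)) m) ->
    ~ (forall m : M, ideal_mul (t ++ s) m) ->
  collapse s a -> ~ (forall m : M, ideal_mul t (a *: m)).
Proof.
elim: s t a => [|x s IHs] t a reg proper.
  case=> u u1 ta; apply: proper => m; rewrite cats0.
  by rewrite -[m]scale1r -u1 mulrC -scalerA; apply: ta.
case=> e [h [b [col_b ->]]] ta.
have tb (m : M) : ideal_mul t ((b + x * h) *: m).
  elim: e ta => [|e IHe] ta; first by have := ta m; rewrite mul1r.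
  apply: IHe => m'; have := reg (size t); rewrite leqnn size_cat /= -addSnnS leq_addr.
  rewrite take_size_cat // nth_cat ltnn subnn /= => /(_ isT); apply.
  by rewrite scalerA mulrA -exprS; apply: ta.
apply: (IHs (rcons t x) b); rewrite ?cat_rcons //.
  move=> i /andP[le_i lt_i].
  by apply: reg; rewrite lt_i andbT (leq_trans _ le_i) // size_rcons.
move=> m.
apply/ideal_mul_rcons; exists ((b + x * h) *: m), (- h *: m); split=> //.
by rewrite scalerA -scalerDl mulrN addrK.
Qed.

End RegularSequences.

Section Dependence.

Variables (k : fieldType) (v : {rmorphism R -> kV k}).

(** A dimension count: [N ^ size s] monomials in [s] have degree linear in [N], hence lie in a space
    of dimension of order [N ^ 3]. *)
Lemma kV_dependent s : (3 < size s)%N -> exists N (c : mon_idx N s -> k),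
  (exists m, c m != 0) /\ \sum_m c m *: v (mon m) = 0.
Proof.
move=> lt_s.
have [D szD] : exists D, forall x, x \in s -> (msize (v x) <= D.+1)%N.
  exists (\max_(x <- s) msize (v x))%N => x xs; apply: leqW.
  exact: (@leq_bigmax_seq _ s xpredT (fun x => msize (v x)) x xs isT).
have szM (f g : kV k) (a b : nat) :
    (msize f <= a.+1)%N -> (msize g <= b.+1)%N -> (msize (f * g) <= (a + b).+1)%N.
  move=> fa gb; have [->|f0] := eqVneq f 0; first by rewrite mul0r msize0.
  have [->|g0] := eqVneq g 0; first by rewrite mulr0 msize0.
  rewrite msizeM //; move: (msize f) (msize g) fa gb => sf sg; lia.
have szX (f : kV k) (a j : nat) : (msize f <= a.+1)%N -> (msize (f ^+ j) <= (j * a).+1)%N.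
  move=> fa; elim: j => [|j IHj]; first by rewrite msize1.
  by rewrite exprS mulSn; apply: szM.
(* Chosen so that [E <= (size s * D).+1 * N] gives [E ^ 3 < N ^ 4]. *)
pose N := (((size s * D).+1 ^ 3).+1)%N; exists N.
pose E := (size s * (N * D)).+1%N.
have szmon (m : mon_idx N s) : (msize (v (mon m)) <= E)%N.
  rewrite /E; elim: (s) szD m => [|x s' IHs] szD' /= m; first by rewrite rmorph1 msize1.
  rewrite rmorphM rmorphXn /= mulSn; apply: szM; last first.
    by apply: IHs => y ys; apply: szD'; rewrite inE ys orbT.
  apply: leq_trans (szX _ D _ (szD' _ (mem_head _ _))) _.
  by rewrite ltnS leq_mul // ltnW.
pose I := mon_idx N s; pose J := {ffun 'I_3 -> 'I_E} : finType.
pose mJ (j : J) := [multinom (j i : nat) | i < 3].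
(* Rows are the coefficient vectors of the monomials in [s]; a left kernel vector is the
   relation. *)
pose A : 'M[k]_(#|I|, #|J|) := \matrix_(i, j) (v (mon (enum_val i)))@_(mJ (enum_val j)).
have ltIJ : (#|J| < #|I|)%N.
  rewrite card_ffun !card_ord card_mon_idx.
  apply: (@leq_trans (N ^ 4)%N); last by rewrite leq_pexp2l.
  rewrite (expnSr N 3).
  have leE : (E <= (size s * D).+1 * N)%N by rewrite /E mulSn; nia.
  apply: (@leq_ltn_trans (((size s * D).+1 * N) ^ 3)%N); first by rewrite leq_exp2r.
  by rewrite expnMn mulnC ltn_pmul2l // expn_gt0.
have : kermx A != 0.
  rewrite -mxrank_eq0 mxrank_ker subn_eq0 -ltnNge.
  exact: leq_ltn_trans (rank_leq_col A) ltIJ.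
case/rowV0Pn=> u /sub_kermxP uA u0.
exists (fun m => u 0 (enum_rank m)); split.
  have [i ui] : exists i, u 0 i != 0.
    apply/existsP; apply: contraNT u0; rewrite negb_exists => /forallP z.
    by apply/eqP/rowP => i; rewrite mxE; apply/eqP; have := z i; rewrite negbK.
  by exists (enum_val i); rewrite enum_valK.
apply/mpolyP => w; rewrite mcoeff0 raddf_sum /=.
have [lt_w|le_w] := ltnP (mdeg w) E; last first.
  rewrite big1 // => m _; rewrite mcoeffZ memN_msupp_eq0 ?mulr0 //.
  by apply: msize_mdeg_ge; apply: leq_trans (szmon m) le_w.
have lt_wi i : (w i < E)%N.
  by apply: leq_ltn_trans lt_w; rewrite mdegE (bigD1 i) //= leq_addr.
pose j : J := [ffun i => Ordinal (lt_wi i)].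
have ej : mJ j = w by apply/mnmP => i; rewrite mnmE ffunE.
have := congr1 (fun B : 'rV__ => B 0 (enum_rank j)) uA; rewrite !mxE => e0; rewrite -[RHS]e0.
rewrite (reindex (@enum_val I predT)) /=; last first.
  by exists enum_rank => ? _; rewrite ?enum_valK ?enum_rankK.
by apply: eq_bigr => i _; rewrite enum_valK mcoeffZ mxE enum_rankK ej.
Qed.

End Dependence.

End Collapse.

(** * Dimension and depth *)

Section CohenMacaulay.

Variables (k : fieldType) (p n : nat).
Hypotheses (p_prime : prime p) (p_odd : odd p) (char_k : p \in [pchar k]).
Hypotheses (n_ge1 : (1 <= n)%N) (n_le_p : (n <= p)%N).

Local Notation R := (kVG k p).
Local Notation M := (kVWG k p n).

Let inv_valr : {rmorphism R -> kV k} := val.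
Let cov_vala : {additive M -> kVW k n} := val.

Lemma cov_val_sum (I : finType) (F : I -> M) :
  cov_val (\sum_i F i) = \sum_i cov_val (F i).
Proof. exact: (raddf_sum cov_vala). Qed.

Lemma evalA_inv P : evalA p P \in invariants k p.
Proof. by apply/(invariants_fixed p_prime)/sigma_evalA. Qed.

Definition invA P : R := Invariant (evalA_inv P).

Lemma gen_cov (i : 'I_(n + n)) : Theta n (gen k p n i) \in covariants k p n.
Proof.
apply/(covariants_fixed p_prime)/(sigma_VW_fixedP _ n_ge1).
exists (gen k p n i) => //.
exact: (Delta_iter_gen p_prime p_odd char_k n_ge1 n_le_p (ltn_ord i)).
Qed.

Definition cgen (i : 'I_(n + n)) : M := Covariant (gen_cov i).

Lemma cgen_span (m : M) : exists c, m = \sum_(i < n + n) invA (c i) *: cgen i.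
Proof.
have /(covariants_span p_prime p_odd char_k n_ge1 n_le_p _)[c e] := cov_valP m.
by exists c; apply: val_inj; rewrite /= e cov_val_sum.
Qed.

(** The first coordinate of [Theta f] is [f], which gives a relation between the generators in
    [k[V]]. *)
Lemma cgen_relation (c : 'I_(n + n) -> kV k) (m : M) :
    \sum_(i < n + n) invA (c i) *: cgen i = invA (x1 k) *: m ->
  forall i, exists Q, c i = x1 k * Q.
Proof.
move=> e.
have /(covariants_fixed p_prime)/(sigma_VW_fixedP _ n_ge1)[g Dg eg] := cov_valP m.
apply: (gen_relation_mod_x3 p_prime p_odd char_k n_ge1 n_le_p (g := g)).
have := congr1 (fun u : M => cov_val u 0 (Ordinal n_ge1)) e.
rewrite cov_val_sum /= eg summxE !mxE evalA1 /= => <-.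
by apply: eq_bigr => i _; rewrite !mxE.
Qed.

Lemma kVWG_finitely_generated : finitely_generated M.
Proof.
exists [seq cgen i | i <- enum 'I_(n + n)] => m.
apply/(@spannedE _ _ _ _ (n + n) cgen); first by rewrite size_map size_enum_ord.
  move=> i; rewrite (nth_map i) ?size_enum_ord // nth_ord_enum //.
by have [c ->] := cgen_span m; exists (fun i => invA (c i)).
Qed.

Lemma invA_x1_torsion_free (m : M) : invA (x1 k) *: m = 0 -> m = 0.
Proof.
move=> e; apply: val_inj; apply/rowP => j.
have := congr1 (fun u : M => cov_val u 0 j) e; rewrite /= !mxE evalA1.
by move/eqP; rewrite mulf_eq0 (negPf (x_neq0 _ _)) => /eqP.
Qed.

Definition hsop : seq R := [:: invA (x1 k); invA (x2 k); invA (x3 k)].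

Lemma cgen_comb_x1 (c : 'I_(n + n) -> kV k) :
    (forall i, exists Q, c i = x1 k * Q) ->
  exists m' : M, \sum_(i < n + n) invA (c i) *: cgen i = invA (x1 k) *: m'.
Proof.
move=> /fin_all_exists[Q eQ]; exists (\sum_(i < n + n) invA (Q i) *: cgen i).
rewrite scaler_sumr; apply: eq_bigr => i _; rewrite scalerA eQ; congr (_ *: _).
by apply: val_inj; rewrite /= rmorphM.
Qed.

Lemma invAM P Q : invA (P * Q) = invA P * invA Q.
Proof. by apply: val_inj; rewrite /= rmorphM. Qed.

Lemma invAB P Q : invA (P - Q) = invA P - invA Q.
Proof. by apply: val_inj; rewrite /= rmorphB. Qed.

Lemma invAD P Q : invA (P + Q) = invA P + invA Q.
Proof. by apply: val_inj; rewrite /= rmorphD. Qed.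

Lemma ideal_mul1 (a : R) (m : M) : ideal_mul [:: a] m <-> exists m', m = a *: m'.
Proof.
rewrite -[[:: a]]/(rcons [::] a) ideal_mul_rcons; split=> [[m1 [m2 [/ideal_mul0 -> ->]]]|[m' ->]].
  by exists m2; rewrite add0r.
by exists 0, m'; rewrite add0r; split=> //; apply/ideal_mul0.
Qed.

Lemma ideal_mul2 (a b : R) (m : M) :
  ideal_mul [:: a; b] m <-> exists m1 m2, m = a *: m1 + b *: m2.
Proof.
rewrite -[[:: a; b]]/(rcons [:: a] b) ideal_mul_rcons.
split=> [[_ [m2 [/ideal_mul1[m1 ->] ->]]]|[m1 [m2 ->]]]; first by exists m1, m2.
by exists (a *: m1), m2; split=> //; apply/ideal_mul1; exists m1.
Qed.

Lemma gen0E : gen k p n 0 = 1.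
Proof. by rewrite /gen n_ge1 /genM. Qed.

Lemma inv_val0_hsop i : (inv_val hsop`_i)@_0%MM = 0.
Proof.
have x0 j : ('X_j : kV k)@_0%MM = 0 by rewrite mcoeffX -mdeg_eq0 mdeg1.
have c0M (f g : kV k) : (f * g)@_0%MM = f@_0%MM * g@_0%MM by exact: (rmorphM (mcoeff 0%MM)).
case: i => [|[|[|i]]] /=; rewrite ?nth_nil ?evalA1 ?evalA2 ?evalA3 ?mcoeff0 //.
- by rewrite mcoeffX -mdeg_eq0 mdeg1.
- by rewrite /a2 /x1 /x2 /x3 expr2 !mcoeffB !c0M !x0 !mulr0 !subr0.
- apply/eqP; rewrite /a3 (rmorph_prod (mcoeff 0%MM)); apply/prodf_eq0.
  by exists (Ordinal (prime_gt0 p_prime)); rewrite //= /x1 x0.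
Qed.

(** The first coordinate of [Theta 1] has a nonzero constant term, whereas [a1, a2, a3] have
    none. *)
Lemma hsop_proper : ~ (forall m : M, ideal_mul hsop m).
Proof.
have lt_0 : (0 < n + n)%N by rewrite addn_gt0 n_ge1.
move=> /(_ (cgen (Ordinal lt_0)))[c].
move=> /(congr1 (fun u : M => (cov_val u 0 (Ordinal n_ge1))@_0%MM)).
rewrite /= mxE /= gen0E mcoeff1 eqxx cov_val_sum summxE raddf_sum big1 => [/eqP|i _].
  by rewrite oner_eq0.
by rewrite /= mxE (rmorphM (mcoeff 0%MM)) /= inv_val0_hsop mul0r.
Qed.

(** Covariants have coefficients in [A], and divisibility by [a1] passes to these coefficients,
    where the variables are regular. *)
Lemma hsop_regular : regular_sequence M hsop.
Proof.
split; last exact: hsop_proper.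
case=> [|[|[|//]]] _ m /=.
- move=> /ideal_mul0 e; apply/ideal_mul0; exact: invA_x1_torsion_free.
- move=> /ideal_mul1[m1 e]; apply/ideal_mul1.
  have [c em] := cgen_span m; rewrite em.
  apply: cgen_comb_x1 => i.
  have [|R' eR] := @cgen_relation (fun i => x2 k * c i) m1 _ i; last exact: x2_colon eR.
  by rewrite -e em scaler_sumr; apply: eq_bigr => j _; rewrite scalerA invAM.
move=> /ideal_mul2[m1 [m2 e]]; apply/ideal_mul2.
have [c em] := cgen_span m; have [d em2] := cgen_span m2.
(* Subtracting the [a2] part leaves a multiple of [a1] with coefficients [x3 c_i - x2 d_i]. *)
have H i : exists Q : kV k * kV k, c i = x1 k * Q.1 + x2 k * Q.2.
  have [|R' eR] := @cgen_relation (fun i => x3 k * c i - x2 k * d i) m1 _ i.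
    rewrite -[RHS](addrK (invA (x2 k) *: m2)) -e em em2 !scaler_sumr -sumrB.
    by apply: eq_bigr => j _; rewrite invAB !invAM scalerBl !scalerA.
  by have [Q1 [Q2 eQ]] := x3_colon eR; exists (Q1, Q2).
have [Q eQ] := fin_all_exists H.
exists (\sum_(i < n + n) invA (Q i).1 *: cgen i), (\sum_(i < n + n) invA (Q i).2 *: cgen i).
rewrite em !scaler_sumr -big_split; apply: eq_bigr => i _.
by rewrite eQ invAD !invAM scalerDl !scalerA.
Qed.

Lemma constant_inv c : c%:MP \in invariants k p.
Proof. by apply/(invariants_fixed p_prime); rewrite sigmaC. Qed.

(** The coefficients of the relation are constants, hence 0 or invertible invariants, as
    [collapse_sum] requires. *)
Lemma collapse0 (s : seq R) : (3 < size s)%N -> collapse s 0.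
Proof.
move=> /(kV_dependent inv_valr)[N [c [c_neq0 e]]].
pose cR m : R := Invariant (constant_inv (c m)).
have <- : \sum_m cR m * mon m = 0.
  apply: val_inj; rewrite (rmorph_sum inv_valr) -[RHS]/(0 : kV k) -[RHS]e.
  by apply: eq_bigr => m _; rewrite -mul_mpolyC.
apply: collapse_sum => [m|].
  have [c0|c0] := eqVneq (c m) 0; [left | right].
    by apply: val_inj; rewrite /= c0.
  exists (Invariant (constant_inv (c m)^-1)); apply: val_inj.
  by rewrite /= -mpolyCM mulVf.
have [m cm] := c_neq0; exists m; apply: contraNneq cm => /(congr1 val)/eqP.
by rewrite /= mpolyC_eq0.
Qed.

Lemma kVWG_depth : has_depth M (@kVG_plus k p) 3.
Proof.
split.
  exists hsop; split=> // [i _|]; last exact: hsop_regular.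
  exact: inv_val0_hsop.
(* Beyond three elements 0 collapses, yet it sends [M] to 0, against [collapse_regular]. *)
move=> e [s [sz _ [reg proper]]]; rewrite leqNgt -sz; apply/negP => /collapse0 col.
apply: (@collapse_regular _ M [::] s 0 _ proper col); first by move=> i /andP[_]; apply: reg.
by move=> m; rewrite scale0r; apply/ideal_mul0.
Qed.

Lemma cgen_torsion_free (a : R) : annihilator M a -> a = 0.
Proof.
have lt_0 : (0 < n + n)%N by rewrite addn_gt0 n_ge1.
move=> /(_ (cgen (Ordinal lt_0))) /(congr1 (fun u : M => cov_val u 0 (Ordinal n_ge1))).
by rewrite /= !mxE /= gen0E mulr1 => e; apply: val_inj.
Qed.

(* [ker (cut i)] is generated by the last [i] of the variables [x1, x2, x3]. *)
Definition cut (i : nat) : {rmorphism kV k -> kV k} :=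
  comp_mpoly [tuple (if (2 < i)%N then 0 else x1 k);
    (if (1 < i)%N then 0 else x2 k); (if (0 < i)%N then 0 else x3 k)].

Lemma cutC i c : cut i c%:MP = c%:MP.
Proof. exact: comp_mpolyC. Qed.
Lemma cut1 i : cut i (x1 k) = if (2 < i)%N then 0 else x1 k.
Proof. exact: comp_mpolyXU. Qed.
Lemma cut2 i : cut i (x2 k) = if (1 < i)%N then 0 else x2 k.
Proof. exact: comp_mpolyXU. Qed.
Lemma cut3 i : cut i (x3 k) = if (0 < i)%N then 0 else x3 k.
Proof. exact: comp_mpolyXU. Qed.

#[local] Opaque cut.

Lemma cut_cut i f : cut i.+1 (cut i f) = cut i.+1 f.
Proof.
apply: (@kV_ext k _ (cut i.+1 \o cut i) (cut i.+1)) => [c|||] /=.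
- by rewrite !cutC.
- by rewrite (cut1 i) (cut1 i.+1); case: (ltnP 2 i) => lt; rewrite ?cut1 // rmorph0 ltnS ltnW.
- by rewrite (cut2 i) (cut2 i.+1); case: (ltnP 1 i) => lt; rewrite ?cut2 // rmorph0 ltnS ltnW.
- by rewrite (cut3 i) (cut3 i.+1); case: (ltnP 0 i) => lt; rewrite ?cut3 // rmorph0 ltnS ltnW.
Qed.

Lemma kVWG_dim : has_dim M 3.
Proof.
split.
  (* The primes 0, [(x3)], [(x2, x3)], [(x1, x2, x3)] intersected with the invariants; [a1, a2, a3]
     witness the strict steps. *)
  exists (fun i a => cut i (inv_val a) = 0); split=> i lt_i.
  - split.
    + split; first exact: rmorph0.
        by move=> a b a0 b0; rewrite /= rmorphD /= a0 b0 addr0.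
      by move=> a b b0; rewrite /= rmorphM /= b0 mulr0.
    + by move/eqP; rewrite /= rmorph1 oner_eq0.
    + by move=> a b /eqP; rewrite /= rmorphM mulf_eq0 => /orP[]/eqP; auto.
  - by move=> a /cgen_torsion_free ->; rewrite rmorph0.
  split; first by move=> a a0; rewrite -cut_cut a0 rmorph0.
  exists hsop`_i; case: i lt_i => [|[|[|//]]] _ /=; split.
  - by rewrite evalA1 cut3.
  - by rewrite evalA1 cut3 => /eqP; rewrite (negPf (x_neq0 _ _)).
  - rewrite evalA2 /a2 !(rmorphB, rmorphM, rmorphXn) /= cut2 cut3 /=.
    by rewrite !mulr0 !subr0.
  - rewrite evalA2 /a2 !(rmorphB, rmorphM, rmorphXn) /= cut2 cut3 /=.
    by rewrite !mulr0 !subr0 => /eqP; rewrite mulf_eq0 (negPf (x_neq0 _ _)).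
  - rewrite evalA3 /a3 rmorph_prod /=; apply/eqP/prodf_eq0.
    by exists (Ordinal (prime_gt0 p_prime)); rewrite //= cut1.
  (* Once [x2 = x3 = 0] the action is trivial, so [a3] becomes [x1 ^ p]. *)
  - have cut_sigma f : cut 2 (sigma f) = cut 2 f.
      apply: (@kV_ext k _ (cut 2 \o @sigma k) (cut 2)) => [c|||] /=.
      - by rewrite sigmaC.
      - by rewrite sigmaX1 rmorphD /= cut2 addr0.
      - by rewrite sigmaX2 rmorphD /= cut3 addr0.
      - by rewrite sigmaX3.
    rewrite evalA3 /a3 rmorph_prod /= => /eqP/prodf_eq0[i _].
    have -> : cut 2 (iter i (@sigma k) (x1 k)) = x1 k.
      by elim: (i : nat) => [|j IHj]; rewrite ?cut1 // iterS cut_sigma.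
    by rewrite (negPf (x_neq0 _ _)).
(* Elements chosen in the successive differences of a longer chain would make 0 collapse, so 0 could
   not lie in [P 0]. *)
move=> d [P [prP _ chP]]; rewrite leqNgt; apply/negP => lt_d.
have ex_x (i : 'I_d) : exists a, P i.+1 a /\ ~ P i a by case: (chP i (ltn_ord i)).
have [x xP] := fin_all_exists ex_x.
pose s := [seq x i | i <- enum 'I_d].
have sz : size s = d by rewrite size_map size_enum_ord.
apply: (@collapse_prime_chain _ P s 0 0).
- by move=> j; rewrite sz; apply: prP.
- move=> j; rewrite sz add0n => lt_j; have [incl _] := chP j lt_j.
  have -> : s`_j = x (Ordinal lt_j).
    rewrite (nth_map (Ordinal lt_j)) ?size_enum_ord //; congr x.
    by apply: val_inj; rewrite /= nth_enum_ord.
  by have [] := xP (Ordinal lt_j).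
- by apply: collapse0; rewrite sz.
- by have [[]] := prP 0%N isT.
Qed.

End CohenMacaulay.

Theorem corollary19 (p n : nat) (k : fieldType) (p_prime : prime p)
    (p_odd : odd p) (char_k : p \in [pchar k]) (n_ge1 : (1 <= n)%N)
    (n_le_p : (n <= p)%N) :
  cohen_macaulay (kVWG k p n) (kVG_plus k p) /\
  (forall phi : kVW k n,
     phi \in covariants k p n <-> spanned (algA k p) (generators k p n) phi).
Proof.
split; last by move=> phi; apply: covariants_spanned.
split; first exact: kVWG_finitely_generated.
by exists 3%N; split; [apply: kVWG_dim | apply: kVWG_depth].
Qed.
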